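(* Consider a non-degenerate regular ladder with $m\ge 2$ steps, and let $\Phi$ be the associated $1$-periodic function. Then the Fourier coefficients $c_n=\int_0^1\Phi(s)e^{-2\pi i n s}\,ds$, $n\in\mathbb{Z}$, of $\Phi$ are given by $$c_n=\frac{\Delta_2(1-\Delta_1)}{\Delta_1\ln(m)}\,\Gamma(\alpha_n)\,\zeta(\alpha_n),\qquad \alpha_n=-\alpha-\frac{2\pi i n}{\ln(m)} ,$$ where $\Gamma$ is the Euler Gamma function and $\zeta$ is the Riemann zeta function.
   Context: Regular ladder: let $m\ge2$, $\Delta_1>0$, $\Delta_2\ge 0$ with $m\Delta_1+(m-1)\Delta_2=1$. Put $a_k=(k-1)(\Delta_1+\Delta_2)$, $b_k=a_k+\Delta_1$ for $k=1,\dots,m$ (so $a_1=0$, $b_m=1$), and $\rho_k=\frac1m$. The (regular generalized Cantor) ladder is the unique continuous function $C:[0,1]\to[0,1]$ with $C(0)=0$, $C(1)=1$ such that $C(t)=\frac{k-1}{m}+\frac1m C\big(\frac{t-a_k}{\Delta_1}\big)$ for $t\in[a_k,b_k]$, $1\le k\le m$, and $C(t)=\frac km$ for $t\in[b_k,a_{k+1}]$, $1\le k\le m-1$. It is monotone. The ladder is non-degenerate if $\Delta_2>0$ (if $\Delta_2=0$ then $C(t)\equiv t$). For $\lambda\geq 0$ let $E(\lambda)=\int_0^1e^{\lambda C(t)}\,dt$. Put $\alpha=\log_m(\Delta_1)$. The function $\Phi$: put $f(\lambda)=E(m\lambda)-\Delta_1e^{(m-1)\lambda}E(\lambda)$, $f_1(\lambda)=\dfrac{f(\lambda)}{\Delta_1\lambda^\alpha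 e^{m\lambda}}$ for $\lambda>0$, and $\Phi(x)=\sum_{k\in\mathbb{Z}}f_1(m^{k+x})$ for $x\in\mathbb{R}$ (the series converges). Equivalently, $\Phi$ is the unique $1$-periodic function on $\mathbb{R}$ for which $E(\lambda)=\Phi(\log_m\lambda)\,\lambda^\alpha e^\lambda+O(1)$ as $\lambda\to\infty$. *)

(* Defs.v *)
From Stdlib Require Import Reals ZArith.
From Coquelicot Require Import Coquelicot.
Open Scope R_scope.

Definition step_left (D1 D2 : R) (k : nat) : R := (INR k - 1) * (D1 + D2).

Definition step_right (D1 D2 : R) (k : nat) : R := step_left D1 D2 k + D1.

Record ladder_parameters (m : nat) (D1 D2 : R) : Prop := {
  ladder_steps : (2 <= m)%nat;
  ladder_D1 : 0 < D1;
  ladder_D2 : 0 <= D2;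
  ladder_total : INR m * D1 + (INR m - 1) * D2 = 1
}.

(* [L] is the ladder function on [0,1]; its values outside [0,1] are
   irrelevant. *)
Record is_regular_ladder (m : nat) (D1 D2 : R) (L : R -> R) : Prop := {
  ladder_continuous : continuous_on (fun t => 0 <= t <= 1) L;
  ladder_range : forall t, 0 <= t <= 1 -> 0 <= L t <= 1;
  ladder_0 : L 0 = 0;
  ladder_1 : L 1 = 1;
  ladder_step : forall (k : nat) (t : R), (1 <= k <= m)%nat ->
    step_left D1 D2 k <= t <= step_right D1 D2 k ->
    L t = (INR k - 1) / INR m + / INR m * L ((t - step_left D1 D2 k) / D1);
  ladder_flat : forall (k : nat) (t : R), (1 <= k <= m - 1)%nat ->
    step_right D1 D2 k <= t <= step_left D1 D2 (S k) ->
    L t = INR k / INR m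
}.

Definition E (L : R -> R) (lam : R) : R :=
  RInt (fun t => exp (lam * L t)) 0 1.

Definition alpha (m : nat) (D1 : R) : R := ln D1 / ln (INR m).

Definition f (m : nat) (D1 : R) (L : R -> R) (lam : R) : R :=
  E L (INR m * lam) - D1 * exp ((INR m - 1) * lam) * E L lam.

Definition f1 (m : nat) (D1 : R) (L : R -> R) (lam : R) : R :=
  f m D1 L lam / (D1 * Rpower lam (alpha m D1) * exp (INR m * lam)).

Definition ZSeries (u : Z -> R) : R :=
  Series (fun k : nat => u (Z.of_nat k))
  + Series (fun k : nat => u (- Z.of_nat (S k))%Z).

Definition Phi (m : nat) (D1 : R) (L : R -> R) (x : R) : R :=
  ZSeries (fun k => f1 m D1 L (Rpower (INR m) (IZR k + x))).

Definition Cexp (z : C) : C :=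
  (exp (Re z) * cos (Im z), exp (Re z) * sin (Im z)).

(* [t ^ s] with the real logarithm of the base, meaningful for [0 < t]. *)
Definition Rcpow (t : R) (s : C) : C := Cexp (s * RtoC (ln t))%C.

(* Euler's integral for Gamma, and below the Dirichlet series for zeta: these
   represent the two functions on [0 < Re s] and [1 < Re s] respectively, and
   have no meaning elsewhere.  No analytic continuation is needed, because
   [Re (alpha_n m D1 n) = - alpha m D1 > 1] for a non-degenerate ladder:
   [0 < D2] forces [INR m * D1 < 1]. *)
Definition Gamma (s : C) : C :=
  RInt_gen (V := C_R_CompleteNormedModule)
    (fun t => (Rcpow t (s - 1) * RtoC (exp (- t)))%C)
    (at_right 0) (Rbar_locally p_infty).

Definition CSeries (u : nat -> C) : C :=
  (Series (fun k => Re (u k)), Series (fun k => Im (u k))).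

Definition zeta (s : C) : C := CSeries (fun k => Rcpow (INR (S k)) (- s)%C).

Definition fourier_coef (g : R -> R) (n : Z) : C :=
  RInt (V := C_R_CompleteNormedModule)
    (fun s => (RtoC (g s) * Cexp (- (2 * RtoC PI * Ci * RtoC (IZR n) * RtoC s)))%C)
    0 1.

Definition alpha_n (m : nat) (D1 : R) (n : Z) : C :=
  (- RtoC (alpha m D1)
   - 2 * RtoC PI * Ci * RtoC (IZR n) / RtoC (ln (INR m)))%C.

(* Main.v *)
Require Import Defs.
From Stdlib Require Import Reals ZArith Lra Lia.
From Coquelicot Require Import Coquelicot.
Open Scope R_scope.

(** Put [w l = 1 / (exp l - 1)] and [G l = exp (- l) * E l].  Cutting [0, 1]
    at the ends of the steps gives
    [(exp l - 1) E (m l) = D1 E l (exp (m l) - 1) + D2 (exp (m l) - exp l)],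
    which rewrites the numerator [G (m l) - D1 G l] of [f1] as
    [D2 (w l - w (m l)) - ((G w) (m l) - D1 (G w) l)].  After division by
    [l ^ alpha], where [m ^ alpha = D1], the last difference telescopes in the
    sum over [l = m ^ (k + x)], so [Phi] does not depend on the ladder:
    [Phi x = D2 (1 - D1) / D1 * sum_k l ^ (- alpha) w l].
    Now expand [w l = sum_j exp (- j l)].  The [j]-th term contributes the
    1-periodic function [Q x = sum_k l ^ (- alpha) exp (- l)] translated by
    [log_m j] and scaled by [j ^ alpha], which on Fourier coefficients is
    multiplication by [j ^ (- alpha_n)]; the [n]-th coefficient of [Q] unfolds
    to Euler's integral for [Gamma (alpha_n) / ln m].  The remainder after
    [J] terms is [O(J ^ (alpha + 1))] uniformly in [x]. *)

(** * Sums over all integers of translates of exponentially decaying functions *)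

Lemma exp_le_compat (x y : R) : x <= y -> exp x <= exp y.
Proof. intros [H| ->]; [apply Rlt_le, exp_increasing, H|lra]. Qed.

(** Comparison with a geometric series. The tail starts at index [S N], so the true bound carries
    one more factor [q], which is dropped. *)
Lemma Series_tail_geom (a : nat -> R) (K q : R) :
  0 < q < 1 -> (forall k, Rabs (a k) <= K * q ^ k) ->
  ex_series a /\
  forall N, Rabs (Series a - sum_f_R0 a N) <= K / (1 - q) * q ^ N.
Proof.
  intros Hq Ha.
  assert (Hg : is_series (fun k => q ^ k) (/ (1 - q))).
  { apply is_series_geom. rewrite Rabs_pos_eq; lra. }
  assert (HK : 0 <= K).
  { generalize (Ha 0%nat) (Rabs_pos (a 0%nat)); simpl; lra. }
  assert (Hex : ex_series a).
  { apply (@ex_series_le R_AbsRing R_CompleteNormedModule a (fun k => K * q ^ k)).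
    - exact Ha.
    - exists (K * / (1 - q)). apply (is_series_scal_l K _ _ Hg). }
  split; [exact Hex|]. intros N.
  rewrite (Series_incr_n a (S N)); [|lia|exact Hex]. simpl pred.
  replace (_ + _ - _) with (Series (fun k => a (S N + k)%nat)) by ring.
  assert (Hb : forall k, 0 <= Rabs (a (S N + k)%nat) <= K * q ^ N * q ^ k).
  { intros k. split; [apply Rabs_pos|].
    eapply Rle_trans; [apply Ha|]. rewrite Rmult_assoc.
    apply Rmult_le_compat_l; [exact HK|]. rewrite <- pow_add.
    replace (S N + k)%nat with (S (N + k)) by lia. simpl.
    assert (0 < q ^ (N + k)) by (apply pow_lt; lra). nra. }
  assert (Hs' : is_series (fun k => K * q ^ N * q ^ k) (K * q ^ N * / (1 - q))).
  { apply (is_series_scal_l (K * q ^ N) _ _ Hg). }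
  assert (Hs : ex_series (fun k => K * q ^ N * q ^ k)) by (eexists; exact Hs').
  eapply Rle_trans; [apply Series_Rabs|].
  { apply (@ex_series_le R_AbsRing R_CompleteNormedModule _ (fun k => K * q ^ N * q ^ k)).
    - intros k. unfold norm; simpl. rewrite Rabs_Rabsolu. apply Hb.
    - exact Hs. }
  eapply Rle_trans; [apply (Series_le _ _ Hb Hs)|].
  rewrite (is_series_unique _ _ Hs'). right; unfold Rdiv; ring.
Qed.

(** The variable is [log_m l], so this is decay like a power of [l] at infinity and like a power of
    [1 / l] at 0. It is what makes sums over integer translates converge uniformly on bounded
    sets. *)
Definition decaying (u : R -> R) : Prop :=
  exists K d, 0 < d /\ forall x, Rabs (u x) <= K * exp (- d * Rabs x).

Lemma decay_constant_nonneg (u : R -> R) (K d : R) :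
  (forall x, Rabs (u x) <= K * exp (- d * Rabs x)) -> 0 <= K.
Proof.
  intros Hu. generalize (Hu 0) (Rabs_pos (u 0)).
  rewrite Rabs_R0, Rmult_0_r, exp_0. lra.
Qed.

(** Periodization of [u]. It is built on [ZSeries] so that [Phi] is convertible to an instance of
    it. *)
Definition zsum (u : R -> R) (x : R) : R := ZSeries (fun k => u (IZR k + x)).

(* The terms with [-(N + 1) <= k <= N]. *)
Definition zpsum (u : R -> R) (N : nat) (x : R) : R :=
  sum_f_R0 (fun k => u (IZR (Z.of_nat k) + x)) N
  + sum_f_R0 (fun k => u (IZR (- Z.of_nat (S k)) + x)) N.

(** The ratio is [q = exp (- d)]; an offset [x] of size at most [B] costs at most the factor
    [exp (d * B)]. Both half-series are indexed from 0 and share one bound, because the arguments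
    stay at distance at least [k - B] from 0. *)
Lemma decaying_geom (u : R -> R) : decaying u -> forall B, exists K q,
  0 < q < 1 /\ forall x, Rabs x <= B -> forall k,
  Rabs (u (IZR (Z.of_nat k) + x)) <= K * q ^ k /\
  Rabs (u (IZR (- Z.of_nat (S k)) + x)) <= K * q ^ k.
Proof.
  intros [K [d [Hd Hu]]] B.
  assert (HK := decay_constant_nonneg u K d Hu).
  exists (K * exp (d * B)), (exp (- d)). split.
  { split; [apply exp_pos|]. rewrite <- exp_0. apply exp_increasing. lra. }
  intros x Hx k.
  assert (Hk : forall z, INR k <= Rabs z + B ->
     Rabs (u z) <= K * exp (d * B) * exp (- d) ^ k).
  { intros z Hz. eapply Rle_trans; [apply Hu|]. rewrite Rmult_assoc.
    apply Rmult_le_compat_l; [exact HK|].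
    rewrite <- Rpower_pow by apply exp_pos. unfold Rpower. rewrite ln_exp, <- exp_plus.
    apply exp_le_compat. nra. }
  assert (Hk0 := pos_INR k).
  split; apply Hk.
  - rewrite <- INR_IZR_INZ. unfold Rabs in *; repeat destruct Rcase_abs; lra.
  - rewrite opp_IZR, <- INR_IZR_INZ, S_INR.
    unfold Rabs in *; repeat destruct Rcase_abs; lra.
Qed.

Lemma decaying_ex_series (u : R -> R) (x : R) : decaying u ->
  ex_series (fun k => u (IZR (Z.of_nat k) + x)) /\
  ex_series (fun k => u (IZR (- Z.of_nat (S k)) + x)).
Proof.
  intros Hu. destruct (decaying_geom u Hu (Rabs x)) as [K [q [Hq H]]].
  split; apply (Series_tail_geom _ K q Hq); intros k; apply (H x (Rle_refl _)).
Qed.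

(** The rate is uniform for bounded [x], which gives both continuity of the sum and its termwise
    integration over a period. *)
Lemma zsum_approx (u : R -> R) : decaying u -> forall B, exists K q,
  0 < q < 1 /\ forall x, Rabs x <= B ->
  forall N, Rabs (zsum u x - zpsum u N x) <= K * q ^ N.
Proof.
  intros Hu B. destruct (decaying_geom u Hu B) as [K [q [Hq H]]].
  exists (2 * (K / (1 - q))), q. split; [exact Hq|]. intros x Hx N.
  destruct (Series_tail_geom _ K q Hq (fun k => proj1 (H x Hx k))) as [_ H1].
  destruct (Series_tail_geom _ K q Hq (fun k => proj2 (H x Hx k))) as [_ H2].
  specialize (H1 N). specialize (H2 N). unfold zsum, ZSeries, zpsum.
  match goal with |- Rabs (?a + ?b - (?c + ?e)) <= _ =>
    replace (a + b - (c + e)) with ((a - c) + (b - e)) by ring end.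
  eapply Rle_trans; [apply Rabs_triang|]. lra.
Qed.

Lemma decaying_le (u v : R -> R) (c : R) :
  decaying v -> (forall x, Rabs (u x) <= c * Rabs (v x)) -> decaying u.
Proof.
  intros [K [d [Hd Hv]]] H. exists (Rabs c * K), d. split; [exact Hd|]. intros x.
  eapply Rle_trans; [apply H|]. rewrite Rmult_assoc.
  specialize (Hv x). generalize (Rle_abs c) (Rabs_pos (v x)) (Rabs_pos c). nra.
Qed.

Lemma decaying_shift (u : R -> R) (a : R) :
  decaying u -> decaying (fun x => u (x + a)).
Proof.
  intros [K [d [Hd Hu]]].
  assert (HK := decay_constant_nonneg u K d Hu).
  exists (K * exp (d * Rabs a)), d. split; [exact Hd|]. intros x.
  eapply Rle_trans; [apply Hu|]. rewrite Rmult_assoc.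
  apply Rmult_le_compat_l; [exact HK|]. rewrite <- exp_plus.
  assert (Rabs x <= Rabs (x + a) + Rabs a).
  { unfold Rabs; repeat destruct Rcase_abs; lra. }
  apply exp_le_compat. nra.
Qed.

Lemma decaying_plus (u v : R -> R) :
  decaying u -> decaying v -> decaying (fun x => u x + v x).
Proof.
  (* Lowering the rate weakens the bound, so both functions can be given the common rate
     [Rmin d d']. *)
  assert (Hm : forall w : R -> R, forall K d d', d' <= d ->
    (forall x, Rabs (w x) <= K * exp (- d * Rabs x)) ->
    forall x, Rabs (w x) <= K * exp (- d' * Rabs x)).
  { intros w K d d' Hd Hw x.
    assert (HK := decay_constant_nonneg w K d Hw).
    eapply Rle_trans; [apply Hw|]. apply Rmult_le_compat_l; [exact HK|].
    generalize (Rabs_pos x); intros Hx.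
    apply exp_le_compat. nra. }
  intros [K [d [Hd Hu]]] [K' [d' [Hd' Hv]]].
  exists (K + K'), (Rmin d d'). split; [apply Rmin_pos; lra|]. intros x.
  eapply Rle_trans; [apply Rabs_triang|].
  generalize (Hm u K d _ (Rmin_l d d') Hu x) (Hm v K' d' _ (Rmin_r d d') Hv x). lra.
Qed.

Lemma zsum_ext (u v : R -> R) (x : R) : (forall y, u y = v y) -> zsum u x = zsum v x.
Proof.
  intros H. unfold zsum, ZSeries. f_equal; apply Series_ext; intros; apply H.
Qed.

Lemma zsum_scal (c : R) (u : R -> R) (x : R) :
  zsum (fun y => c * u y) x = c * zsum u x.
Proof. unfold zsum, ZSeries. rewrite 2!Series_scal_l. ring. Qed.

Lemma zsum_plus (u v : R -> R) (x : R) : decaying u -> decaying v ->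
  zsum (fun y => u y + v y) x = zsum u x + zsum v x.
Proof.
  intros Hu Hv. unfold zsum, ZSeries.
  destruct (decaying_ex_series u x Hu), (decaying_ex_series v x Hv).
  rewrite 2!Series_plus by assumption. ring.
Qed.

Lemma zsum_shift (u : R -> R) (a x : R) :
  zsum (fun y => u (y + a)) x = zsum u (x + a).
Proof.
  unfold zsum, ZSeries. f_equal; apply Series_ext; intros; f_equal; ring.
Qed.

Lemma zsum_le (u v : R -> R) (x : R) : decaying v -> (forall y, 0 <= u y <= v y) ->
  0 <= zsum u x <= zsum v x.
Proof.
  intros Hv H. unfold zsum, ZSeries.
  assert (Hu : decaying u).
  { apply (decaying_le u v 1 Hv). intros y. destruct (H y).
    rewrite 2!Rabs_pos_eq; lra. }
  destruct (decaying_ex_series u x Hu), (decaying_ex_series v x Hv).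
  assert (Hp : forall a, (forall k, 0 <= a k) -> ex_series a -> 0 <= Series a).
  { intros a Ha Hex. rewrite <- (Rmult_0_l (Series a)), <- Series_scal_l.
    apply Series_le; [|exact Hex]. intros k. specialize (Ha k). lra. }
  split.
  - apply Rplus_le_le_0_compat; apply Hp; try assumption; intros; apply H.
  - apply Rplus_le_compat; apply Series_le; try assumption; intros; apply H.
Qed.

(** Moving [x] by 1 transfers the single term [u x] from the nonnegative half-series to the head of
    the negative one. *)
Lemma zsum_periodic (u : R -> R) (x : R) : decaying u -> zsum u (x + 1) = zsum u x.
Proof.
  intros Hu.
  destruct (decaying_ex_series u x Hu) as [H1 _].
  destruct (decaying_ex_series u (x + 1) Hu) as [_ H2].
  unfold zsum, ZSeries. rewrite (Series_incr_1 _ H1), (Series_incr_1 _ H2).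
  rewrite (Series_ext (fun k => u (IZR (Z.of_nat k) + (x + 1)))
    (fun k => u (IZR (Z.of_nat (S k)) + x))).
  2: intros k; rewrite <- 2!INR_IZR_INZ, S_INR; f_equal; ring.
  rewrite (Series_ext (fun k => u (IZR (- Z.of_nat (S (S k))) + (x + 1)))
    (fun k => u (IZR (- Z.of_nat (S k)) + x))).
  2: intros k; rewrite 2!opp_IZR, <- 2!INR_IZR_INZ, (S_INR (S k)); f_equal; ring.
  replace (IZR (- Z.of_nat 1) + (x + 1)) with x by (simpl; ring).
  replace (IZR (Z.of_nat 0) + x) with x by (simpl; ring).
  ring.
Qed.

Lemma periodic_IZR (g : R -> R) : (forall x, g (x + 1) = g x) ->
  forall (n : Z) x, g (x + IZR n) = g x.
Proof.
  intros H. assert (Hn : forall (k : nat) x, g (x + INR k) = g x).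
  { induction k; intros x; [simpl; f_equal; ring|].
    rewrite S_INR, <- Rplus_assoc, H. apply IHk. }
  intros n x. destruct (Z.le_ge_cases 0 n) as [h|h].
  - rewrite <- (Z2Nat.id n h), <- INR_IZR_INZ. apply Hn.
  - rewrite <- (Hn (Z.to_nat (- n)) (x + IZR n)). f_equal.
    rewrite INR_IZR_INZ, Z2Nat.id, opp_IZR by lia. ring.
Qed.

Lemma pow_eventually (K q eps : R) : 0 < q < 1 -> 0 < eps ->
  exists N, forall n, (N <= n)%nat -> K * q ^ n < eps.
Proof.
  (* The denominator [Rabs K + 1] is positive whatever the value and sign of [K]. *)
  intros Hq He. destruct (pow_lt_1_zero q) with (y := eps / (Rabs K + 1)) as [N HN].
  - rewrite Rabs_pos_eq; lra.
  - apply Rdiv_lt_0_compat; [exact He|]. generalize (Rabs_pos K); lra.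
  - exists N. intros n Hn. specialize (HN n Hn).
    assert (0 < q ^ n) by (apply pow_lt; lra).
    rewrite Rabs_pos_eq in HN by lra.
    apply (Rmult_lt_compat_l (Rabs K + 1)) in HN; [|generalize (Rabs_pos K); lra].
    replace ((Rabs K + 1) * (eps / (Rabs K + 1))) with eps in HN.
    2: field; generalize (Rabs_pos K); lra.
    generalize (Rle_abs K). nra.
Qed.

Lemma continuous_shift (g : R -> R) (a x : R) :
  (forall y, continuous g y) -> continuous (fun x => g (x + a)) x.
Proof.
  intros Hg. apply (continuous_comp (fun x => x + a) g); [|apply Hg].
  apply (continuous_plus (fun x => x) (fun _ => a));
    [apply continuous_id|apply continuous_const].
Qed.

Lemma continuous_sum_shift (u : R -> R) (z : nat -> R) (N : nat) (x : R) :
  (forall y, continuous u y) -> continuous (fun x => sum_f_R0 (fun k => u (z k + x)) N) x.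
Proof.
  intros Hu.
  assert (H : forall k, continuous (fun x => u (z k + x)) x).
  { intros k. apply (continuous_ext (fun x => u (x + z k))); [intros; f_equal; ring|].
    apply continuous_shift, Hu. }
  induction N; simpl; [apply H|].
  apply (continuous_plus (fun x => sum_f_R0 (fun k => u (z k + x)) N)); auto.
Qed.

Lemma zpsum_continuous (u : R -> R) (N : nat) (x : R) :
  (forall y, continuous u y) -> continuous (zpsum u N) x.
Proof.
  intros Hu. apply (continuous_plus (fun x => sum_f_R0 (fun k => u (IZR (Z.of_nat k) + x)) N)).
  - apply (continuous_sum_shift u (fun k => IZR (Z.of_nat k))), Hu.
  - apply (continuous_sum_shift u (fun k => IZR (- Z.of_nat (S k)))), Hu.
Qed.

(** The partial sums are continuous and converge uniformly on the ball around 0 of radius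
    [Rabs x + 1], which contains [x]. *)
Lemma zsum_continuous (u : R -> R) (x : R) :
  decaying u -> (forall y, continuous u y) -> continuous (zsum u) x.
Proof.
  intros Hu Hc. apply continuity_pt_filterlim.
  assert (HB : 0 < Rabs x + 1) by (generalize (Rabs_pos x); lra).
  apply (CVU_continuity (zpsum u) (zsum u) 0 (mkposreal _ HB)).
  - intros eps He. destruct (zsum_approx u Hu (Rabs x + 1)) as [K [q [Hq H]]].
    destruct (pow_eventually K q eps Hq He) as [N HN].
    exists N. intros n y Hn Hy. eapply Rle_lt_trans; [apply H|apply HN, Hn].
    unfold Boule in Hy; simpl in Hy. rewrite Rminus_0_r in Hy. lra.
  - intros n y _. apply continuity_pt_filterlim, zpsum_continuous, Hc.
  - unfold Boule; simpl. rewrite Rminus_0_r. lra.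
Qed.

(** Periodicity reduces [x] to its fractional part; there the sum is the two terms of [zpsum u 0],
    each at most [K], up to an error [K']. *)
Lemma zsum_bounded (u : R -> R) : decaying u ->
  exists M, forall x, Rabs (zsum u x) <= M.
Proof.
  intros Hu. destruct (decaying_geom u Hu 1) as [K [q [Hq H]]].
  destruct (zsum_approx u Hu 1) as [K' [q' [Hq' H']]].
  exists (K' + (K + K)). intros x.
  replace (zsum u x) with (zsum u (x - IZR (Int_part x))).
  2: { rewrite <- (periodic_IZR _ (fun y => zsum_periodic u y Hu) (- Int_part x) x).
       f_equal. rewrite opp_IZR. ring. }
  set (y := x - _).
  assert (Hy : Rabs y <= 1).
  { destruct (base_fp x). unfold frac_part in *. fold y in H0, H1.
    rewrite Rabs_pos_eq; lra. }
  specialize (H y Hy 0%nat). specialize (H' y Hy 0%nat). destruct H as [Ha Hb].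
  unfold zpsum, sum_f_R0 in H'. simpl pow in *. rewrite Rmult_1_r in *.
  set (a := u _) in *. set (b := u (IZR (- _) + _)) in *.
  replace (zsum u y) with ((zsum u y - (a + b)) + (a + b)) by ring.
  eapply Rle_trans; [apply Rabs_triang|].
  generalize (Rabs_triang a b). lra.
Qed.

(** * Unfolding: the integral of a periodization over one period is an integral over the line *)

Lemma ex_RInt_cont (g : R -> R) (a b : R) : (forall x, continuous g x) -> ex_RInt g a b.
Proof. intros H. apply (@ex_RInt_continuous R_CompleteNormedModule). auto. Qed.

Lemma RInt_shift (g : R -> R) (v a b : R) : (forall x, continuous g x) ->
  RInt (fun x => g (x + v)) a b = RInt g (a + v) (b + v).
Proof.
  intros Hg. generalize (RInt_comp_lin (V := R_CompleteNormedModule) g 1 v a b).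
  rewrite 2!Rmult_1_l. intros H. rewrite <- H by (apply ex_RInt_cont, Hg).
  apply RInt_ext. intros x _. unfold scal; simpl; unfold mult; simpl.
  rewrite 2!Rmult_1_l. reflexivity.
Qed.

Lemma RInt_reflect (g : R -> R) (a b : R) : (forall x, continuous g x) ->
  RInt g (- a) (- b) = - RInt (fun x => g (- x)) a b.
Proof.
  intros Hg. generalize (RInt_comp_lin (V := R_CompleteNormedModule) g (-1) 0 a b).
  replace (-1 * a + 0) with (- a) by ring. replace (-1 * b + 0) with (- b) by ring.
  intros H. rewrite <- H by (apply ex_RInt_cont, Hg).
  rewrite <- (RInt_opp (V := R_CompleteNormedModule)).
  - apply RInt_ext. intros x _. unfold scal, opp; simpl; unfold mult; simpl.
    replace (-1 * x + 0) with (- x) by ring. ring.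
  - apply ex_RInt_cont. intros x. apply (continuous_comp (fun x => - x) g); [|apply Hg].
    apply (continuous_opp (fun x : R => x)), continuous_id.
Qed.

Lemma RInt_plus_cont (g h : R -> R) (a b : R) :
  (forall x, continuous g x) -> (forall x, continuous h x) ->
  RInt (fun x => g x + h x) a b = RInt g a b + RInt h a b.
Proof.
  intros Hg Hh. apply (RInt_plus (V := R_CompleteNormedModule)); apply ex_RInt_cont; assumption.
Qed.

Lemma RInt_Chasles_cont (g : R -> R) (b a c : R) : (forall x, continuous g x) ->
  RInt g a c = RInt g a b + RInt g b c.
Proof.
  intros Hg. symmetry. apply (RInt_Chasles (V := R_CompleteNormedModule)); apply ex_RInt_cont, Hg.
Qed.

Lemma RInt_sum_shift (u : R -> R) (z : nat -> R) (N : nat) (a b : R) :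
  (forall y, continuous u y) ->
  RInt (fun x => sum_f_R0 (fun k => u (z k + x)) N) a b
  = sum_f_R0 (fun k => RInt u (a + z k) (b + z k)) N.
Proof.
  intros Hu.
  assert (H : forall k, RInt (fun x => u (z k + x)) a b = RInt u (a + z k) (b + z k)).
  { intros k. rewrite <- RInt_shift by exact Hu. apply RInt_ext. intros; f_equal; ring. }
  induction N; simpl; [apply H|].
  rewrite (RInt_plus_cont (fun x => sum_f_R0 (fun k => u (z k + x)) N)).
  - rewrite IHN, H. reflexivity.
  - intros; apply continuous_sum_shift, Hu.
  - intros y. apply (continuous_ext (fun x => u (x + z (S N)))); [intros; f_equal; ring|].
    apply continuous_shift, Hu.
Qed.

(** The [2 (N + 1)] translates of the unit interval tile the interval from [- (N + 1)] to [N + 1];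
    each half is assembled by induction. *)
Lemma RInt_zpsum (u : R -> R) (N : nat) : (forall x, continuous u x) ->
  RInt (zpsum u N) 0 1 = RInt u (- INR (S N)) (INR (S N)).
Proof.
  intros Hu. unfold zpsum. rewrite RInt_plus_cont.
  2: intros; apply (continuous_sum_shift u (fun k => IZR (Z.of_nat k))), Hu.
  2: intros; apply (continuous_sum_shift u (fun k => IZR (- Z.of_nat (S k)))), Hu.
  rewrite (RInt_sum_shift u (fun k => IZR (Z.of_nat k))) by exact Hu.
  rewrite (RInt_sum_shift u (fun k => IZR (- Z.of_nat (S k)))) by exact Hu.
  rewrite (RInt_Chasles_cont u 0) by exact Hu. rewrite Rplus_comm. f_equal.
  - induction N as [|n IH]; [simpl; f_equal; ring|]. rewrite tech5, IH.
    rewrite (RInt_Chasles_cont u (- INR (S n)) (- INR (S (S n)))) by exact Hu.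
    rewrite Rplus_comm. f_equal.
    rewrite opp_IZR, <- INR_IZR_INZ, (S_INR (S n)). f_equal; ring.
  - induction N as [|n IH]; [simpl; f_equal; ring|]. rewrite tech5, IH.
    rewrite (RInt_Chasles_cont u (INR (S n)) 0 (INR (S (S n)))) by exact Hu.
    f_equal. rewrite <- INR_IZR_INZ, (S_INR (S n)). f_equal; ring.
Qed.

Lemma RInt_exp_le (K d p q : R) : 0 < d -> 0 <= K -> 
  RInt (fun x => K * exp (- d * x)) p q <= K / d * exp (- d * p).
Proof.
  intros Hd HK.
  rewrite (is_RInt_unique (V := R_CompleteNormedModule) _ p q (K / d * exp (- d * p) - K / d * exp (- d * q))).
  - assert (0 <= K / d) by (apply Rdiv_le_0_compat; lra).
    generalize (exp_pos (- d * q)). nra.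
  - replace (K / d * exp (- d * p) - K / d * exp (- d * q))
      with (minus (- (K / d) * exp (- d * q)) (- (K / d) * exp (- d * p)))
      by (unfold minus, plus, opp; simpl; ring).
    apply (is_RInt_derive (V := R_CompleteNormedModule) (fun x => - (K / d) * exp (- d * x))).
    + intros x _. auto_derive; [trivial|]. field. lra.
    + intros x _. apply (ex_derive_continuous (V := R_NormedModule)). auto_derive. trivial.
Qed.

(** The order of [p] and [q] is left free, since a later endpoint may fall on either side of the
    last tile. *)
Lemma decaying_RInt_tail (u : R -> R) (K d : R) : 0 < d -> (forall x, continuous u x) ->
  (forall x, Rabs (u x) <= K * exp (- d * Rabs x)) ->
  forall B p q, 0 <= B -> B <= p -> B <= q -> Rabs (RInt u p q) <= K / d * exp (- d * B).
Proof.
  intros Hd Hc Hu.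
  assert (HK := decay_constant_nonneg u K d Hu).
  assert (Hw : forall B p q, 0 <= B -> B <= p -> p <= q ->
    Rabs (RInt u p q) <= K / d * exp (- d * B)).
  { intros B p q HB Hp Hq.
    eapply Rle_trans; [apply abs_RInt_le; [exact Hq|apply ex_RInt_cont, Hc]|].
    eapply Rle_trans.
    - apply (RInt_le _ (fun x => K * exp (- d * x))); [exact Hq| | |].
      + apply ex_RInt_cont. intros x. apply (continuous_comp u Rabs); [apply Hc|].
        apply continuous_Rabs.
      + apply ex_RInt_cont. intros x. apply (ex_derive_continuous (V := R_NormedModule)).
        auto_derive. trivial.
      + intros x Hx. rewrite <- (Rabs_pos_eq x) at 2 by lra. apply Hu.
    - eapply Rle_trans; [apply RInt_exp_le; assumption|].
      apply Rmult_le_compat_l; [apply Rdiv_le_0_compat; lra|].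
      apply exp_le_compat. nra. }
  intros B p q HB Hp Hq. destruct (Rle_lt_dec p q) as [h|h].
  - apply Hw; assumption.
  - rewrite <- (opp_RInt_swap (V := R_CompleteNormedModule)) by (apply ex_RInt_cont, Hc).
    unfold opp; simpl. rewrite Rabs_Ropp. apply Hw; lra.
Qed.

(** An argument with three errors: the two tails outside the tiled interval, and the uniform
    distance from [zpsum u N] to [zsum u] on a period. The two-endpoint form is the one that
    survives a change of variable in an improper integral. *)
Lemma RInt_zsum_limit (u : R -> R) : decaying u -> (forall x, continuous u x) ->
  forall eps, 0 < eps -> exists B, forall y z, y <= - B -> B <= z ->
  Rabs (RInt u y z - RInt (zsum u) 0 1) < eps.
Proof.
  intros Hu Hc eps He.
  assert (Hu' := Hu). destruct Hu' as [K [d [Hd Hb]]].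
  destruct (zsum_approx u Hu 1) as [K' [q [Hq Hz]]].
  destruct (pow_eventually (K / d) (exp (- d)) (eps / 3)) as [N1 HN1].
  { split; [apply exp_pos|]. rewrite <- exp_0. apply exp_increasing. lra. }
  { lra. }
  destruct (pow_eventually K' q (eps / 3) Hq) as [N2 HN2]; [lra|].
  set (N := max N1 N2).
  specialize (HN1 N (Nat.le_max_l _ _)). specialize (HN2 N (Nat.le_max_r _ _)).
  assert (HP : K / d * exp (- d * INR N) < eps / 3).
  { rewrite <- Rpower_pow in HN1 by apply exp_pos. unfold Rpower in HN1.
    rewrite ln_exp in HN1. rewrite Rmult_comm in HN1.
    replace (- d * INR N) with (INR N * - d) by ring. lra. }
  exists (INR N). intros y z Hy Hz'.
  assert (HN0 := pos_INR N).
  assert (HS : INR N <= INR (S N)) by (rewrite S_INR; lra).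
  assert (H1 : Rabs (RInt u (INR (S N)) z) < eps / 3).
  { eapply Rle_lt_trans; [|exact HP].
    apply (decaying_RInt_tail u K d); assumption. }
  assert (H2 : Rabs (RInt u y (- INR (S N))) < eps / 3).
  { eapply Rle_lt_trans; [|exact HP].
    rewrite <- (Ropp_involutive y), RInt_reflect, Rabs_Ropp by exact Hc.
    apply (decaying_RInt_tail (fun x => u (- x)) K d); try assumption; try lra.
    - intros x. apply (continuous_comp (fun x => - x) u); [|apply Hc].
      apply (continuous_opp (fun x : R => x)), continuous_id.
    - intros x. rewrite <- (Rabs_Ropp x). apply Hb. }
  assert (H3 : Rabs (RInt u (- INR (S N)) (INR (S N)) - RInt (zsum u) 0 1) < eps / 3).
  { eapply Rle_lt_trans; [|exact HN2]. rewrite <- RInt_zpsum by exact Hc.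
    rewrite <- (RInt_minus (V := R_CompleteNormedModule)).
    2,3: apply ex_RInt_cont; intros;
         first [apply zsum_continuous; assumption | apply zpsum_continuous; assumption].
    rewrite <- (Rmult_1_l (K' * q ^ N)). rewrite <- (Rminus_0_r 1) at 2.
    apply abs_RInt_le_const; [lra| |].
    - apply ex_RInt_cont. intros x.
      apply (continuous_minus (zpsum u N) (zsum u)).
      + apply zpsum_continuous; assumption.
      + apply zsum_continuous; assumption.
    - intros t Ht. change (Rabs (zpsum u N t - zsum u t) <= K' * q ^ N).
      rewrite Rabs_minus_sym. apply Hz. rewrite Rabs_pos_eq; lra. }
  rewrite (RInt_Chasles_cont u (- INR (S N)) y z) by exact Hc.
  rewrite (RInt_Chasles_cont u (INR (S N)) (- INR (S N)) z) by exact Hc.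
  apply Rabs_def2 in H1, H2, H3. apply Rabs_def1; lra.
Qed.

(** * Self-similarity of the ladder and the functional equation of [E] *)

(** The composite of [L] with this retraction onto [[0, 1]] is continuous on the whole line, so the
    integration lemmas for everywhere continuous functions apply to it. *)
Definition clamp (t : R) : R := Rmax 0 (Rmin 1 t).

Lemma clamp_range (t : R) : 0 <= clamp t <= 1.
Proof. unfold clamp, Rmax, Rmin. repeat destruct Rle_dec; lra. Qed.

Lemma clamp_id (t : R) : 0 <= t <= 1 -> clamp t = t.
Proof. intros H. unfold clamp, Rmax, Rmin. repeat destruct Rle_dec; lra. Qed.

Lemma clamp_lipschitz (s t : R) : Rabs (clamp s - clamp t) <= Rabs (s - t).
Proof.
  unfold clamp, Rmax, Rmin, Rabs.
  repeat destruct Rle_dec; repeat destruct Rcase_abs; lra.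
Qed.

Lemma continuous_clamp (L : R -> R) (x : R) :
  continuous_on (fun t => 0 <= t <= 1) L -> continuous (fun t => L (clamp t)) x.
Proof.
  intros H P HP. specialize (H (clamp x) (clamp_range x) P HP).
  unfold filtermap, within in *. destruct H as [e He].
  exists e. intros y Hy. apply He; [|apply clamp_range].
  eapply Rle_lt_trans; [apply clamp_lipschitz|exact Hy].
Qed.

Lemma continuous_exp_ladder (m : nat) (D1 D2 : R) (L : R -> R) (lam x : R) :
  is_regular_ladder m D1 D2 L -> continuous (fun t => exp (lam * L (clamp t))) x.
Proof.
  intros HL. apply (continuous_comp (fun t => lam * L (clamp t)) exp).
  - apply (continuous_scal_r (V := R_NormedModule) lam (fun t => L (clamp t))).
    apply continuous_clamp, HL.
  - apply continuity_pt_filterlim, derivable_continuous_pt, derivable_pt_exp.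
Qed.

Lemma E_clamp (L : R -> R) (lam : R) :
  E L lam = RInt (fun t => exp (lam * L (clamp t))) 0 1.
Proof.
  unfold E. apply RInt_ext. intros x Hx.
  rewrite Rmin_left, Rmax_right in Hx by lra. rewrite clamp_id by lra. reflexivity.
Qed.

Lemma E_bounds (m : nat) (D1 D2 : R) (L : R -> R) (lam : R) :
  is_regular_ladder m D1 D2 L -> 0 <= lam -> 0 <= E L lam <= exp lam.
Proof.
  intros HL Hlam. rewrite E_clamp. set (g := fun t => _).
  assert (Hc : forall x, continuous g x) by (intros; eapply continuous_exp_ladder, HL).
  assert (Hb : forall t, 0 <= g t <= exp lam).
  { intros t. unfold g. split; [apply Rlt_le, exp_pos|].
    destruct (ladder_range _ _ _ _ HL (clamp t) (clamp_range t)) as [h1 h2].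
    apply exp_le_compat. nra. }
  split.
  - apply RInt_ge_0; [lra|apply ex_RInt_cont, Hc|]. intros; apply Hb.
  - replace (exp lam) with (RInt (fun _ => exp lam) 0 1).
    + apply RInt_le; [lra|apply ex_RInt_cont, Hc| |intros; apply Hb].
      apply ex_RInt_cont. intros; apply continuous_const.
    + rewrite RInt_const. unfold scal; simpl; unfold mult; simpl. ring.
Qed.

(** Substitute [t = a + D1 * s] on the [k]-th step: self-similarity turns the exponent [m lam L(t)]
    into [(k - 1) lam + lam L(s)]. *)
Lemma ladder_piece (m : nat) (D1 D2 : R) (L : R -> R) (lam : R) (k : nat) :
  ladder_parameters m D1 D2 -> is_regular_ladder m D1 D2 L -> (1 <= k <= m)%nat ->
  RInt (fun t => exp (INR m * lam * L (clamp t))) (step_left D1 D2 k) (step_right D1 D2 k)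
  = D1 * exp ((INR k - 1) * lam) * E L lam.
Proof.
  intros HP HL Hk. destruct HP as [Hm HD1 HD2 HT].
  assert (Hk1 : 1 <= INR k) by (apply (le_INR 1); lia).
  assert (Hkm : INR k <= INR m) by (apply le_INR; lia).
  assert (Hm0 : INR m <> 0) by lra.
  set (g := fun t => exp (INR m * lam * L (clamp t))).
  assert (Hc : forall x, continuous g x) by (intros; eapply continuous_exp_ladder, HL).
  set (a := step_left D1 D2 k).
  assert (Ha : 0 <= a /\ a + D1 <= 1) by (unfold a, step_left; split; nra).
  generalize (RInt_comp_lin (V := R_CompleteNormedModule) g D1 a 0 1).
  replace (D1 * 0 + a) with a by ring.
  replace (D1 * 1 + a) with (step_right D1 D2 k) by (unfold step_right; fold a; ring).
  intros H. rewrite <- H by (apply ex_RInt_cont, Hc).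
  rewrite E_clamp, <- (RInt_scal (V := R_CompleteNormedModule)).
  2: apply ex_RInt_cont; intros; eapply continuous_exp_ladder, HL.
  apply RInt_ext. intros s Hs. rewrite Rmin_left, Rmax_right in Hs by lra.
  unfold scal; simpl; unfold mult; simpl. rewrite Rmult_assoc. f_equal.
  unfold g. rewrite <- exp_plus. f_equal.
  rewrite !clamp_id by nra.
  rewrite (ladder_step _ _ _ _ HL k (D1 * s + a) Hk).
  2: unfold step_right; fold a; nra.
  fold a. replace ((D1 * s + a - a) / D1) with s by (field; lra). field. exact Hm0.
Qed.

Lemma ladder_gap (m : nat) (D1 D2 : R) (L : R -> R) (lam : R) (k : nat) :
  ladder_parameters m D1 D2 -> is_regular_ladder m D1 D2 L -> (1 <= k <= m - 1)%nat ->
  RInt (fun t => exp (INR m * lam * L (clamp t))) (step_right D1 D2 k) (step_left D1 D2 (S k))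
  = D2 * exp (INR k * lam).
Proof.
  intros HP HL Hk. destruct HP as [Hm HD1 HD2 HT].
  assert (Hk1 : 1 <= INR k) by (apply (le_INR 1); lia).
  assert (Hkm : INR k + 1 <= INR m) by (rewrite <- S_INR; apply le_INR; lia).
  assert (HS := S_INR k).
  rewrite (RInt_ext _ (fun _ => exp (INR k * lam))).
  - rewrite RInt_const. unfold scal; simpl; unfold mult; simpl. f_equal.
    unfold step_right, step_left. rewrite HS. ring.
  - assert (Hle : step_right D1 D2 k <= step_left D1 D2 (S k)).
    { unfold step_right, step_left. rewrite HS. nra. }
    rewrite Rmin_left, Rmax_right by exact Hle.
    intros t Ht. rewrite clamp_id.
    + rewrite (ladder_flat _ _ _ _ HL k t Hk) by lra. f_equal. field. lra.
    + unfold step_right, step_left in Ht. rewrite HS in Ht. nra.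
Qed.

(** The steps and the gaps each contribute a geometric progression of ratio [exp lam]. The factor
    [exp lam - 1] makes both telescope, without a division that would fail at [lam = 0]. Each
    induction step adds one step and the gap after it. *)
Lemma ladder_partial (m : nat) (D1 D2 : R) (L : R -> R) (lam : R) (n : nat) :
  ladder_parameters m D1 D2 -> is_regular_ladder m D1 D2 L -> (n < m)%nat ->
  (exp lam - 1) * RInt (fun t => exp (INR m * lam * L (clamp t))) 0 (step_left D1 D2 (S n))
  = D1 * E L lam * (exp (INR n * lam) - 1) + D2 * (exp (INR (S n) * lam) - exp lam).
Proof.
  intros HP HL. set (g := fun t => exp (INR m * lam * L (clamp t))).
  assert (Hc : forall x, continuous g x) by (intros; eapply continuous_exp_ladder, HL).
  induction n as [|n IH]; intros Hn.
  - unfold step_left. simpl INR.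
    replace ((1 - 1) * (D1 + D2)) with 0 by ring. rewrite RInt_point.
    unfold zero; simpl. rewrite Rmult_0_l, exp_0, Rmult_1_l. ring.
  - rewrite (RInt_Chasles_cont g (step_left D1 D2 (S n))) by exact Hc.
    rewrite (RInt_Chasles_cont g (step_right D1 D2 (S n)) (step_left D1 D2 (S n))) by exact Hc.
    rewrite Rmult_plus_distr_l, IH by lia.
    unfold g. rewrite (ladder_piece m D1 D2 L), (ladder_gap m D1 D2 L) by (assumption || lia).
    replace ((INR (S n) - 1) * lam) with (INR n * lam) by (rewrite S_INR; ring).
    replace (INR (S (S n)) * lam) with (lam + (lam + INR n * lam)) by (rewrite 2!S_INR; ring).
    replace (INR (S n) * lam) with (lam + INR n * lam) by (rewrite S_INR; ring).
    rewrite !exp_plus. ring.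
Qed.

(** The complete step-gap pairs are covered by [ladder_partial]; the last step, which has no gap
    after it, is added separately. *)
Lemma E_functional (m : nat) (D1 D2 : R) (L : R -> R) (lam : R) :
  ladder_parameters m D1 D2 -> is_regular_ladder m D1 D2 L ->
  (exp lam - 1) * E L (INR m * lam)
  = D1 * E L lam * (exp (INR m * lam) - 1) + D2 * (exp (INR m * lam) - exp lam).
Proof.
  intros HP HL. set (g := fun t => exp (INR m * lam * L (clamp t))).
  assert (Hc : forall x, continuous g x) by (intros; eapply continuous_exp_ladder, HL).
  destruct (Nat.le_exists_sub 1 m) as [n [Hn _]]; [destruct HP; lia|].
  assert (HSn : S n = m) by lia.
  rewrite (E_clamp L (INR m * lam)). fold g.
  replace (RInt g 0 1) with (RInt g 0 (step_right D1 D2 m)).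
  2: { f_equal. destruct HP. unfold step_right, step_left. lra. }
  rewrite (RInt_Chasles_cont g (step_left D1 D2 m)), Rmult_plus_distr_l by exact Hc.
  unfold g. rewrite (ladder_piece m D1 D2 L) by (assumption || lia).
  assert (Hn' : (n < m)%nat) by lia.
  assert (Hpart := ladder_partial m D1 D2 L lam n HP HL Hn').
  rewrite HSn in Hpart. rewrite Hpart.
  replace ((INR m - 1) * lam) with (INR n * lam) by (rewrite <- HSn, S_INR; ring).
  replace (INR m * lam) with (lam + INR n * lam) by (rewrite <- HSn, S_INR; ring).
  rewrite exp_plus. ring.
Qed.

(** * The densities behind Gamma and zeta, and the expansion of [1 / (exp l - 1)] *)

(* With [l = exp (b * y)], these are [l ^ p * exp (- c * l)] and [l ^ p / (exp l - 1)]. *)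
Definition gamma_density (b p c y : R) : R := exp (p * (b * y) - c * exp (b * y)).
Definition planck (b p y : R) : R := exp (p * (b * y)) / (exp (exp (b * y)) - 1).

Lemma exp_sub_one_pos (x : R) : 0 < x -> 0 < exp x - 1.
Proof. intros H. generalize (exp_ineq1 x). lra. Qed.

Lemma exp_ge_quarter_sqr (x : R) : 0 <= x -> x * x / 4 <= exp x.
Proof.
  intros Hx. replace (exp x) with (exp (x / 2) * exp (x / 2)).
  2: rewrite <- exp_plus; f_equal; field.
  generalize (exp_ineq1_le (x / 2)). nra.
Qed.

(** For [y <= 0] the power factor alone decays at rate [p * b]. For [y > 0], put [t = b * y]:
    [exp t >= t^2 / 4] and the inequality [2 p t <= 4 p^2 / c + c t^2 / 4] between the means give
    the same rate, with [4 p^2 / c] passing into the constant. *)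
Lemma gamma_density_decaying (b p c : R) : 0 < b -> 0 < p -> 0 < c ->
  decaying (gamma_density b p c).
Proof.
  intros Hb Hp Hc. exists (exp (4 * p * p / c)), (p * b). split; [nra|].
  intros y. unfold gamma_density.
  rewrite Rabs_pos_eq by apply Rlt_le, exp_pos. rewrite <- exp_plus. apply exp_le_compat.
  assert (Hpc : 0 <= 4 * p * p / c) by (apply Rdiv_le_0_compat; nra).
  destruct (Rle_lt_dec y 0) as [h|h].
  - rewrite Rabs_left1 by exact h. generalize (exp_pos (b * y)). nra.
  - rewrite Rabs_pos_eq by lra.
    assert (He := exp_ge_quarter_sqr (b * y)). 
    assert (Hby : 0 <= b * y) by nra. specialize (He Hby).
    assert (Hk : 2 * p * (b * y) <= 4 * p * p / c + c * ((b * y) * (b * y) / 4)).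
    { replace (4 * p * p / c) with (c * ((2 * p / c) * (2 * p / c))) by (field; lra).
      replace (2 * p * (b * y)) with (c * (2 * ((2 * p / c) * ((b * y) / 2)))) by (field; lra).
      assert (0 <= ((2 * p / c) - b * y / 2) ^ 2) by apply pow2_ge_0. nra. }
    nra.
Qed.

Lemma gamma_density_continuous (b p c y : R) : continuous (gamma_density b p c) y.
Proof.
  apply (ex_derive_continuous (V := R_NormedModule)). unfold gamma_density.
  auto_derive. trivial.
Qed.

(** Multiplying [l] by [c] is translating [y] by [ln c / b]; the power [l ^ p] accounts for the
    factor [c ^ (- p)]. *)
Lemma gamma_density_scale (b p c y : R) : b <> 0 -> 0 < c ->
  gamma_density b p c y = exp (- p * ln c) * gamma_density b p 1 (y + ln c / b).
Proof.
  intros Hb Hc. unfold gamma_density. rewrite <- exp_plus. f_equal.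
  replace (b * (y + ln c / b)) with (b * y + ln c) by (field; exact Hb).
  rewrite exp_plus, exp_ln by exact Hc. ring.
Qed.

Lemma planck_pos (b p y : R) : 0 < planck b p y.
Proof.
  apply Rdiv_lt_0_compat; [apply exp_pos|]. apply exp_sub_one_pos, exp_pos.
Qed.

(** With [h = exp (l / 2) >= 1 + l / 2], one has [2 (h^2 - 1) >= l (h + 1) >= l h]. The singularity
    at [l = 0] thus costs one power of [l], whence the exponent [p - 1] and the condition [1 < p]
    for decay. *)
Lemma planck_le (b p y : R) : planck b p y <= 2 * gamma_density b (p - 1) (/ 2) y.
Proof.
  unfold planck, gamma_density. set (l := exp (b * y)).
  assert (Hl : 0 < l) by apply exp_pos.
  assert (Hexp : exp l = exp (l / 2) * exp (l / 2)).
  { rewrite <- exp_plus. f_equal. field. }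
  assert (Hh := exp_ineq1_le (l / 2)).
  replace ((p - 1) * (b * y) - / 2 * l) with (p * (b * y) + - (b * y) + - (l / 2)) by field.
  rewrite 2!exp_plus, 2!exp_Ropp. fold l. rewrite Hexp.
  assert (0 < exp (p * (b * y))) by apply exp_pos.
  set (A := exp (p * (b * y))) in *. set (h := exp (l / 2)) in *.
  apply Rle_div_l; [nra|].
  replace (2 * (A * / l * / h) * (h * h - 1)) with (A * (2 * (h * h - 1) / (l * h))).
  2: { field. split; lra. }
  assert (1 <= 2 * (h * h - 1) / (l * h)).
  { apply Rle_div_r; nra. }
  nra.
Qed.

Lemma planck_decaying (b p : R) : 0 < b -> 1 < p -> decaying (planck b p).
Proof.
  intros Hb Hp. apply (decaying_le _ (gamma_density b (p - 1) (/ 2)) 2).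
  - apply gamma_density_decaying; lra.
  - intros y. rewrite 2!Rabs_pos_eq.
    + apply planck_le.
    + apply Rlt_le, exp_pos.
    + apply Rlt_le, planck_pos.
Qed.

Lemma planck_continuous (b p y : R) : continuous (planck b p) y.
Proof.
  apply (ex_derive_continuous (V := R_NormedModule)). unfold planck.
  auto_derive.
  generalize (exp_sub_one_pos _ (exp_pos (b * y))). intros H; lra.
Qed.

(** Closed form of the remainder of the geometric expansion, the sum of [l ^ p * exp (- j * l)] over
    [j > J]; [J = 0] gives back [planck]. *)
Definition planck_rest (b p : R) (J : nat) (y : R) : R :=
  exp (- (INR J * exp (b * y))) * planck b p y.

Lemma planck_rest_bounds (b p : R) (J : nat) (y : R) :
  0 <= planck_rest b p J y <= gamma_density b (p - 1) (INR J) y.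
Proof.
  unfold planck_rest, planck, gamma_density. set (l := exp (b * y)).
  assert (Hl : 0 < l) by apply exp_pos.
  split.
  - apply Rmult_le_pos; [apply Rlt_le, exp_pos|]. apply Rlt_le, (planck_pos b p y).
  - replace ((p - 1) * (b * y) - INR J * l) with (- (INR J * l) + (p * (b * y) + - (b * y))) by ring.
    rewrite 2!exp_plus, (exp_Ropp (b * y)). fold l.
    apply Rmult_le_compat_l; [apply Rlt_le, exp_pos|].
    unfold Rdiv. apply Rmult_le_compat_l; [apply Rlt_le, exp_pos|].
    apply Rinv_le_contravar; [exact Hl|]. generalize (exp_ineq1_le l). lra.
Qed.

(* One step of the geometric series [1 / (exp l - 1) = sum_j exp (- j * l)]. *)
Lemma planck_rest_step (b p : R) (J : nat) (y : R) :
  planck_rest b p J y = gamma_density b p (INR (S J)) y + planck_rest b p (S J) y.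
Proof.
  unfold planck_rest, planck, gamma_density. set (l := exp (b * y)).
  assert (Hl := exp_sub_one_pos l (exp_pos _)).
  replace (p * (b * y) - INR (S J) * l) with (p * (b * y) + - (INR J * l) + - l) by (rewrite S_INR; ring).
  replace (- (INR (S J) * l)) with (- (INR J * l) + - l) by (rewrite S_INR; ring).
  rewrite 3!exp_plus, (exp_Ropp l).
  field. split; [lra|]. apply Rgt_not_eq, exp_pos.
Qed.

Lemma planck_rest_decaying (b p : R) (J : nat) : 0 < b -> 1 < p ->
  decaying (planck_rest b p J).
Proof.
  intros Hb Hp. apply (decaying_le _ (planck b p) 1); [apply planck_decaying; assumption|].
  intros y. unfold planck_rest. rewrite Rabs_mult.
  apply Rmult_le_compat_r; [apply Rabs_pos|].
  rewrite Rabs_pos_eq by apply Rlt_le, exp_pos. rewrite <- exp_0. apply exp_le_compat.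
  generalize (pos_INR J) (exp_pos (b * y)). nra.
Qed.

Lemma planck_rest_continuous (b p : R) (J : nat) (y : R) : continuous (planck_rest b p J) y.
Proof.
  apply (continuous_mult (fun y => exp (- (INR J * exp (b * y)))) (planck b p)).
  - apply (ex_derive_continuous (V := R_NormedModule)). auto_derive. trivial.
  - apply planck_continuous.
Qed.

(** After periodization, the term of index [J + 1] is a scaled translate of one fixed periodic
    function. *)
Lemma zsum_planck_rest_step (b p x : R) (J : nat) : 0 < b -> 1 < p ->
  zsum (planck_rest b p J) x
  = exp (- p * ln (INR (S J))) * zsum (gamma_density b p 1) (x + ln (INR (S J)) / b)
    + zsum (planck_rest b p (S J)) x.
Proof.
  intros Hb Hp. assert (HJ : 0 < INR (S J)) by (apply lt_0_INR; lia).
  rewrite (zsum_ext _ _ x (planck_rest_step b p J)), zsum_plus.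
  - f_equal. rewrite <- zsum_shift, <- zsum_scal. apply zsum_ext. intros y.
    apply gamma_density_scale; lra.
  - apply gamma_density_decaying; lra.
  - apply planck_rest_decaying; assumption.
Qed.

(** From [exp l - 1 >= l], the remainder lies below a [gamma_density] of exponent [p - 1]. Rescaling
    extracts [(J + 1) ^ (1 - p)] and leaves a translate of a bounded periodization, hence uniformity
    in [x]. *)
Lemma zsum_planck_rest_le (b p : R) : 0 < b -> 1 < p -> exists M, forall J x,
  0 <= zsum (planck_rest b p (S J)) x <= M * exp (- (p - 1) * ln (INR (S J))).
Proof.
  intros Hb Hp.
  destruct (zsum_bounded (gamma_density b (p - 1) 1)) as [M HM].
  { apply gamma_density_decaying; lra. }
  exists M. intros J x.
  assert (Hj : 0 < INR (S J)) by (apply lt_0_INR; lia).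
  assert (Hle := zsum_le (planck_rest b p (S J)) (gamma_density b (p - 1) (INR (S J))) x).
  destruct Hle as [H1 H2].
  { apply gamma_density_decaying; lra. }
  { intros y. apply planck_rest_bounds. }
  split; [exact H1|]. eapply Rle_trans; [exact H2|].
  rewrite (zsum_ext _ (fun y => exp (- (p - 1) * ln (INR (S J)))
    * gamma_density b (p - 1) 1 (y + ln (INR (S J)) / b))).
  2: { intros y. apply gamma_density_scale; lra. }
  rewrite (zsum_scal _ (fun y => gamma_density b (p - 1) 1 (y + ln (INR (S J)) / b))).
  rewrite zsum_shift, Rmult_comm. apply Rmult_le_compat_r; [apply Rlt_le, exp_pos|].
  eapply Rle_trans; [apply Rle_abs|apply HM].
Qed.

(** * Elimination of the ladder from [Phi] *)

Lemma ln_steps_pos (m : nat) (D1 D2 : R) : ladder_parameters m D1 D2 -> 0 < ln (INR m).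
Proof.
  intros HP. rewrite <- ln_1. apply ln_increasing; [lra|]. apply (lt_INR 1).
  destruct HP; lia.
Qed.

Lemma alpha_lt (m : nat) (D1 D2 : R) : ladder_parameters m D1 D2 -> 0 < D2 ->
  1 < - alpha m D1.
Proof.
  intros HP HD2. assert (Hb := ln_steps_pos m D1 D2 HP). destruct HP as [Hm HD1 _ HT].
  assert (HM : 2 <= INR m) by (apply (le_INR 2); exact Hm).
  assert (Hln : ln (INR m * D1) < 0).
  { rewrite <- ln_1. apply ln_increasing; nra. }
  rewrite ln_mult in Hln by lra. unfold alpha.
  apply (Rmult_lt_reg_r (ln (INR m))); [exact Hb|].
  replace (- (ln D1 / ln (INR m)) * ln (INR m)) with (- ln D1) by (field; lra). lra.
Qed.

(** Here [V] is [l ^ (- alpha)] times the product [G w]. Passing from [y] to [y + 1] replaces [l] by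
    [m l] and divides [l ^ (- alpha)] by [D1], which is why the shifted terms carry the factor
    [D1]. *)
Lemma f1_planck (m : nat) (D1 D2 : R) (L : R -> R) (y : R) :
  ladder_parameters m D1 D2 -> is_regular_ladder m D1 D2 L ->
  let W := planck (ln (INR m)) (- alpha m D1) in
  let V := fun y => W y * (E L (exp (ln (INR m) * y)) * exp (- exp (ln (INR m) * y))) in
  D1 * f1 m D1 L (Rpower (INR m) y)
  = D2 * (W y + - D1 * W (y + 1)) + - D1 * (V (y + 1) + -1 * V y).
Proof.
  intros HP HL W V. assert (Hb := ln_steps_pos m D1 D2 HP).
  unfold f1, Defs.f, V, W, planck. set (b := ln (INR m)) in *.
  assert (HR : Rpower (INR m) y = exp (b * y)) by (unfold Rpower; f_equal; unfold b; ring).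
  rewrite !HR. set (l := exp (b * y)). unfold Rpower.
  assert (HM : 2 <= INR m) by (apply (le_INR 2); destruct HP; assumption).
  assert (Hl : 0 < l) by apply exp_pos.
  assert (HD1 := ladder_D1 _ _ _ HP).
  assert (Hl1 : exp (b * (y + 1)) = INR m * l).
  { rewrite Rmult_plus_distr_l, Rmult_1_r, exp_plus. fold l. unfold b.
    rewrite exp_ln by lra. ring. }
  rewrite Hl1.
  assert (HA1 : exp (- alpha m D1 * (b * (y + 1))) = exp (- alpha m D1 * (b * y)) / D1).
  { rewrite Rmult_plus_distr_l, Rmult_1_r, Rmult_plus_distr_l, exp_plus. unfold Rdiv. f_equal.
    replace (- alpha m D1 * b) with (- ln D1) by (unfold alpha; fold b; field; lra).
    rewrite exp_Ropp, exp_ln by exact HD1. reflexivity. }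
  rewrite HA1.
  replace (exp (alpha m D1 * ln l)) with (/ exp (- alpha m D1 * (b * y))).
  2: { rewrite <- exp_Ropp. f_equal. unfold l. rewrite ln_exp. ring. }
  replace ((INR m - 1) * l) with (INR m * l + - l) by ring.
  rewrite exp_plus, 2!exp_Ropp.
  assert (HE := E_functional m D1 D2 L l HP HL).
  assert (HX : 0 < exp l - 1) by (apply exp_sub_one_pos, Hl).
  assert (HZ : 0 < exp (INR m * l) - 1) by (apply exp_sub_one_pos; nra).
  assert (HA := exp_pos (- alpha m D1 * (b * y))).
  revert HE HX HZ HA.
  (* Once the exponentials and the two values of [E] are abstract, solving the functional equation
     for [E2] leaves a rational identity. *)
  generalize (exp (- alpha m D1 * (b * y))), (exp l), (exp (INR m * l)), (E L l), (E L (INR m * l)).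
  intros A X Z E1 E2 HE HX HZ HA.
  replace E2 with ((D1 * E1 * (Z - 1) + D2 * (Z - X)) / (X - 1)).
  2: { rewrite <- HE. field. lra. }
  field. repeat split; lra.
Qed.

(** Periodizations do not see a shift by 1: the [V] terms cancel, and the [W] terms combine with the
    coefficient [1 - D1]. *)
Lemma Phi_planck (m : nat) (D1 D2 : R) (L : R -> R) (x : R) :
  ladder_parameters m D1 D2 -> 0 < D2 -> is_regular_ladder m D1 D2 L ->
  Phi m D1 L x = D2 * (1 - D1) / D1 * zsum (planck (ln (INR m)) (- alpha m D1)) x.
Proof.
  intros HP HD2 HL. assert (Hb := ln_steps_pos m D1 D2 HP).
  assert (Hp := alpha_lt m D1 D2 HP HD2).
  assert (Hid := fun y => f1_planck m D1 D2 L y HP HL). cbv zeta in Hid.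
  set (W := planck (ln (INR m)) (- alpha m D1)) in *.
  set (V := fun y => W y * (E L (exp (ln (INR m) * y)) * exp (- exp (ln (INR m) * y)))) in *.
  assert (HW : decaying W) by (apply planck_decaying; assumption).
  assert (HV : decaying V).
  (* The extra factor [E l * exp (- l)] lies between 0 and 1, so [V] inherits the decay of [W]. *)
  { apply (decaying_le _ W 1 HW). intros y. unfold V. rewrite Rabs_mult, Rmult_comm.
    apply Rmult_le_compat_r; [apply Rabs_pos|].
    set (l := exp _). assert (Hl : 0 < l) by apply exp_pos.
    destruct (E_bounds m D1 D2 L l HL) as [h1 h2]; [lra|].
    assert (He := exp_pos (- l)).
    rewrite Rabs_pos_eq by nra.
    replace 1 with (exp l * exp (- l)).
    - apply Rmult_le_compat_r; lra.
    - rewrite <- exp_plus, Rplus_opp_r. apply exp_0. }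
  assert (HD1 := ladder_D1 _ _ _ HP).
  apply (Rmult_eq_reg_l D1); [|lra].
  assert (Hsc : forall c u, decaying u -> decaying (fun y => c * u y)).
  { intros c u Hu. apply (decaying_le _ u (Rabs c) Hu). intros y. rewrite Rabs_mult. lra. }
  change (Phi m D1 L x) with (zsum (fun y => f1 m D1 L (Rpower (INR m) y)) x).
  rewrite <- zsum_scal, (zsum_ext _ _ x Hid).
  assert (HW1 := decaying_shift W 1 HW). assert (HV1 := decaying_shift V 1 HV).
  rewrite (zsum_plus (fun y => D2 * (W y + - D1 * W (y + 1)))
                     (fun y => - D1 * (V (y + 1) + -1 * V y))).
  2: apply Hsc, decaying_plus; [exact HW|apply (Hsc (- D1) _ HW1)].
  2: apply Hsc, decaying_plus; [exact HV1|apply (Hsc (-1) _ HV)].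
  rewrite (zsum_scal D2 (fun y => W y + - D1 * W (y + 1))).
  rewrite (zsum_scal (- D1) (fun y => V (y + 1) + -1 * V y)).
  rewrite (zsum_plus W (fun y => - D1 * W (y + 1))); [|exact HW|apply (Hsc (- D1) _ HW1)].
  rewrite (zsum_plus (fun y => V (y + 1)) (fun y => -1 * V y)); [|exact HV1|apply (Hsc (-1) _ HV)].
  rewrite (zsum_scal (- D1) (fun y => W (y + 1))), (zsum_scal (-1) V).
  rewrite (zsum_shift W), (zsum_shift V), (zsum_periodic W), (zsum_periodic V) by assumption.
  field. lra.
Qed.

(** * Calculus of Fourier coefficients *)

Lemma periodic_2PI (h : R -> R) (n : Z) (x : R) : (forall t, h (t + 2 * PI) = h t) ->
  h (2 * PI * IZR n * (x + 1)) = h (2 * PI * IZR n * x).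
Proof.
  intros Hh.
  assert (H1 : forall t, h (2 * PI * (t + 1)) = h (2 * PI * t)).
  { intros t. rewrite Rmult_plus_distr_l, Rmult_1_r. apply Hh. }
  replace (2 * PI * IZR n * (x + 1)) with (2 * PI * (IZR n * x + IZR n)) by ring.
  rewrite (periodic_IZR (fun t => h (2 * PI * t)) H1). f_equal. ring.
Qed.

Lemma cos_IZR_periodic (n : Z) (x : R) :
  cos (2 * PI * IZR n * (x + 1)) = cos (2 * PI * IZR n * x).
Proof. apply periodic_2PI. intros t. rewrite cos_plus, cos_2PI, sin_2PI. ring. Qed.

Lemma sin_IZR_periodic (n : Z) (x : R) :
  sin (2 * PI * IZR n * (x + 1)) = sin (2 * PI * IZR n * x).
Proof. apply periodic_2PI. intros t. rewrite sin_plus, cos_2PI, sin_2PI. ring. Qed.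

Lemma continuous_mult_cos (g : R -> R) (n : Z) (x : R) : (forall y, continuous g y) ->
  continuous (fun s => g s * cos (2 * PI * IZR n * s)) x.
Proof.
  intros Hg. apply (continuous_mult g (fun s => cos (2 * PI * IZR n * s))); [apply Hg|].
  apply (ex_derive_continuous (V := R_NormedModule)). auto_derive. trivial.
Qed.

Lemma continuous_mult_sin (g : R -> R) (n : Z) (x : R) : (forall y, continuous g y) ->
  continuous (fun s => g s * sin (2 * PI * IZR n * s)) x.
Proof.
  intros Hg. apply (continuous_mult g (fun s => sin (2 * PI * IZR n * s))); [apply Hg|].
  apply (ex_derive_continuous (V := R_NormedModule)). auto_derive. trivial.
Qed.

Lemma is_RInt_cont (g : R -> R) (a b : R) : (forall x, continuous g x) ->
  is_RInt g a b (RInt g a b).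
Proof.
  intros Hg. apply (RInt_correct (V := R_CompleteNormedModule)), ex_RInt_cont, Hg.
Qed.

(** Passing to components reduces the rules below to real integrals of continuous functions. *)
Lemma fourier_coef_pair (g : R -> R) (n : Z) : (forall x, continuous g x) ->
  fourier_coef g n = (RInt (fun s => g s * cos (2 * PI * IZR n * s)) 0 1,
                      - RInt (fun s => g s * sin (2 * PI * IZR n * s)) 0 1).
Proof.
  intros Hg. apply (is_RInt_unique (V := C_R_CompleteNormedModule)).
  assert (Hph : forall s, (RtoC (g s) * Cexp (- (2 * RtoC PI * Ci * RtoC (IZR n) * RtoC s)))%C
    = (g s * cos (2 * PI * IZR n * s), - (g s * sin (2 * PI * IZR n * s)))).
  { intros s. unfold Cexp, Cmult, Copp, RtoC, Ci, Re, Im; simpl.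
    match goal with |- (g s * (exp ?u * cos ?v) - _, _) = _ =>
      replace u with 0 by ring; replace v with (- (2 * PI * IZR n * s)) by ring end.
    rewrite exp_0, cos_neg, sin_neg. f_equal; ring. }
  apply (is_RInt_ext (V := C_R_CompleteNormedModule) (fun s => (g s * cos (2 * PI * IZR n * s), - (g s * sin (2 * PI * IZR n * s))))).
  { intros; symmetry; apply Hph. }
  apply (is_RInt_fct_extend_pair (U := R_NormedModule) (V := R_NormedModule)); simpl.
  - apply is_RInt_cont. intros. apply continuous_mult_cos, Hg.
  - apply (is_RInt_opp (V := R_NormedModule) (fun s => g s * sin (2 * PI * IZR n * s))).
    apply is_RInt_cont. intros. apply continuous_mult_sin, Hg.
Qed.

Lemma RInt_scal_cont (c : R) (g : R -> R) (a b : R) : (forall x, continuous g x) ->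
  RInt (fun x => c * g x) a b = c * RInt g a b.
Proof.
  intros Hg. apply (RInt_scal (V := R_CompleteNormedModule) g). apply ex_RInt_cont, Hg.
Qed.

Lemma continuous_scal_cont (c : R) (g : R -> R) (x : R) : continuous g x ->
  continuous (fun x => c * g x) x.
Proof. apply (continuous_scal_r (V := R_NormedModule) c g). Qed.

Lemma fourier_coef_ext (g h : R -> R) (n : Z) : (forall x, g x = h x) ->
  fourier_coef g n = fourier_coef h n.
Proof.
  intros H. apply (RInt_ext (V := C_R_CompleteNormedModule)). intros x _.
  rewrite H. reflexivity.
Qed.

Lemma fourier_coef_scal (c : R) (g : R -> R) (n : Z) : (forall x, continuous g x) ->
  fourier_coef (fun x => c * g x) n = (RtoC c * fourier_coef g n)%C.
Proof.
  intros Hg. rewrite 2!fourier_coef_pair by (intros; try apply continuous_scal_cont; apply Hg).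
  rewrite (RInt_ext _ (fun s => c * (g s * cos (2 * PI * IZR n * s)))) by (intros; simpl; ring).
  rewrite (RInt_ext (fun s => c * g s * _) (fun s => c * (g s * sin (2 * PI * IZR n * s)))) by (intros; simpl; ring).
  rewrite (RInt_scal_cont c (fun s => g s * cos (2 * PI * IZR n * s))) by (intros; apply continuous_mult_cos, Hg).
  rewrite (RInt_scal_cont c (fun s => g s * sin (2 * PI * IZR n * s))) by (intros; apply continuous_mult_sin, Hg).
  unfold Cmult, RtoC; simpl. f_equal; ring.
Qed.

Lemma fourier_coef_plus (g h : R -> R) (n : Z) :
  (forall x, continuous g x) -> (forall x, continuous h x) ->
  fourier_coef (fun x => g x + h x) n = (fourier_coef g n + fourier_coef h n)%C.
Proof.
  intros Hg Hh. rewrite 3!fourier_coef_pair by (intros; try apply (continuous_plus g h); auto).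
  rewrite (RInt_ext _ (fun s => g s * cos (2 * PI * IZR n * s) + h s * cos (2 * PI * IZR n * s))) by (intros; simpl; ring).
  rewrite (RInt_ext (fun s => (g s + h s) * _) (fun s => g s * sin (2 * PI * IZR n * s) + h s * sin (2 * PI * IZR n * s))) by (intros; simpl; ring).
  rewrite 2!RInt_plus_cont by (intros; first [apply continuous_mult_cos | apply continuous_mult_sin]; assumption).
  unfold Cplus; simpl. f_equal; ring.
Qed.

(** The piece over [[1, 1 + a]] equals the one over [[0, a]]; with oriented integrals this covers
    both signs of [a]. *)
Lemma RInt_periodic_shift (g : R -> R) (a : R) :
  (forall x, continuous g x) -> (forall x, g (x + 1) = g x) ->
  RInt (fun x => g (x + a)) 0 1 = RInt g 0 1.
Proof.
  intros Hc Hp. rewrite RInt_shift by exact Hc.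
  rewrite (RInt_Chasles_cont g 0), (RInt_Chasles_cont g 1 0) by exact Hc.
  replace (RInt g 1 (1 + a)) with (RInt g 0 a).
  - rewrite (RInt_Chasles_cont g a 0 1), Rplus_0_l by exact Hc.
    assert (H := RInt_Chasles_cont g a 0 0 Hc). rewrite RInt_point in H.
    unfold zero in H; simpl in H. lra.
  - rewrite (RInt_ext g (fun x => g (x + 1))) by (intros; symmetry; apply Hp).
    rewrite RInt_shift by exact Hc. f_equal; ring.
Qed.

(** Write [w * x = w * (x + a) - w * a] and expand by the subtraction formulas; the products of [g]
    with cosine and sine are again 1-periodic, so their shifted integrals do not change. *)
Lemma fourier_coef_shift (g : R -> R) (a : R) (n : Z) :
  (forall x, continuous g x) -> (forall x, g (x + 1) = g x) ->
  fourier_coef (fun x => g (x + a)) n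
  = ((cos (2 * PI * IZR n * a), sin (2 * PI * IZR n * a)) * fourier_coef g n)%C.
Proof.
  intros Hc Hp.
  rewrite 2!fourier_coef_pair by (intros; try apply continuous_shift; auto).
  set (w := 2 * PI * IZR n).
  set (gc := fun s => g s * cos (w * s)). set (gs := fun s => g s * sin (w * s)).
  assert (Hgc : forall x, continuous gc x) by (intros; apply continuous_mult_cos, Hc).
  assert (Hgs : forall x, continuous gs x) by (intros; apply continuous_mult_sin, Hc).
  assert (Pc : RInt (fun x => gc (x + a)) 0 1 = RInt gc 0 1).
  { apply RInt_periodic_shift; [exact Hgc|]. intros x. unfold gc, w.
    rewrite Hp, cos_IZR_periodic. reflexivity. }
  assert (Ps : RInt (fun x => gs (x + a)) 0 1 = RInt gs 0 1).
  { apply RInt_periodic_shift; [exact Hgs|]. intros x. unfold gs, w.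
    rewrite Hp, sin_IZR_periodic. reflexivity. }
  assert (Hgc' : forall c x, continuous (fun x => c * gc (x + a)) x).
  { intros. apply continuous_scal_cont, (continuous_shift gc), Hgc. }
  assert (Hgs' : forall c x, continuous (fun x => c * gs (x + a)) x).
  { intros. apply continuous_scal_cont, (continuous_shift gs), Hgs. }
  rewrite (RInt_ext _ (fun x => cos (w * a) * gc (x + a) + sin (w * a) * gs (x + a))).
  2: { intros x _. unfold gc, gs. replace (w * x) with (w * (x + a) - w * a) by ring.
       rewrite cos_minus. simpl; ring. }
  rewrite (RInt_ext (fun s => g (s + a) * _) (fun x => cos (w * a) * gs (x + a) + (- sin (w * a)) * gc (x + a))).
  2: { intros x _. unfold gc, gs. replace (w * x) with (w * (x + a) - w * a) by ring.
       rewrite sin_minus. simpl; ring. }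
  rewrite (RInt_plus_cont (fun x => cos (w * a) * gc (x + a))) by (intros; auto).
  rewrite (RInt_plus_cont (fun x => cos (w * a) * gs (x + a))) by (intros; auto).
  rewrite (RInt_scal_cont _ (fun x => gc (x + a))) by (intros; apply (continuous_shift gc), Hgc).
  rewrite (RInt_scal_cont _ (fun x => gs (x + a))) by (intros; apply (continuous_shift gs), Hgs).
  rewrite (RInt_scal_cont _ (fun x => gc (x + a))) by (intros; apply (continuous_shift gc), Hgc).
  rewrite (RInt_scal_cont _ (fun x => gs (x + a))) by (intros; apply (continuous_shift gs), Hgs).
  rewrite Pc, Ps. unfold Cmult; simpl. f_equal; ring.
Qed.

Lemma fourier_coef_bound (g : R -> R) (n : Z) (M : R) :
  (forall x, continuous g x) -> (forall x, Rabs (g x) <= M) ->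
  Rabs (Re (fourier_coef g n)) <= M /\ Rabs (Im (fourier_coef g n)) <= M.
Proof.
  intros Hc HM. rewrite fourier_coef_pair by exact Hc. simpl.
  assert (H : forall h : R -> R, (forall x, continuous (fun s => g s * h s) x) ->
    (forall s, -1 <= h s <= 1) -> Rabs (RInt (fun s => g s * h s) 0 1) <= M).
  { intros h Hh Hb. replace M with ((1 - 0) * M) by ring.
    apply abs_RInt_le_const; [lra|apply ex_RInt_cont, Hh|].
    intros t _. rewrite Rabs_mult.
    assert (Hbt : Rabs (h t) <= 1) by (apply Rabs_le, Hb).
    generalize (HM t) (Rabs_pos (g t)) (Rabs_pos (h t)). nra. }
  split; [|rewrite Rabs_Ropp]; apply H.
  - intros; apply continuous_mult_cos, Hc.
  - intros; apply COS_bound.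
  - intros; apply continuous_mult_sin, Hc.
  - intros; apply SIN_bound.
Qed.

(** * Euler's integral as a Fourier coefficient *)

Lemma zsum_mult_periodic (u c : R -> R) (x : R) : (forall y, c (y + 1) = c y) ->
  zsum (fun y => u y * c y) x = zsum u x * c x.
Proof.
  intros Hc. rewrite Rmult_comm, <- zsum_scal. unfold zsum, ZSeries.
  f_equal; apply Series_ext; intros k;
    rewrite (Rplus_comm (IZR _) x), (periodic_IZR c Hc); apply Rmult_comm.
Qed.

(** The Fourier kernel is 1-periodic, so it passes inside the periodization and the coefficient
    unfolds to an integral over the line. The substitution [t = exp (b * y)] turns it into Euler's
    integral, and [dt = b * t * dy] supplies the factor [ln m]. *)
Lemma Gamma_fourier (m : nat) (D1 D2 : R) (n : Z) :
  ladder_parameters m D1 D2 -> 0 < D2 ->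
  Gamma (alpha_n m D1 n)
  = (RtoC (ln (INR m)) * fourier_coef (zsum (gamma_density (ln (INR m)) (- alpha m D1) 1)) n)%C.
Proof.
  intros HP HD2. assert (Hb := ln_steps_pos m D1 D2 HP).
  assert (Hp := alpha_lt m D1 D2 HP HD2).
  set (b := ln (INR m)) in *. set (p := - alpha m D1) in *.
  set (u := gamma_density b p 1). set (w := 2 * PI * IZR n).
  assert (Hu : decaying u) by (apply gamma_density_decaying; lra).
  assert (Hc : forall x, continuous u x) by (intros; apply gamma_density_continuous).
  rewrite fourier_coef_pair by (intros; apply zsum_continuous; assumption).
  fold w. set (uc := fun y => u y * cos (w * y)). set (us := fun y => u y * - sin (w * y)).
  assert (Hcc : forall x, continuous uc x) by (intros; apply continuous_mult_cos, Hc).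
  assert (Hcs : forall x, continuous us x).
  { intros x. apply (continuous_ext (fun y => - (u y * sin (w * y)))).
    - intros; unfold us; simpl; ring.
    - apply (continuous_opp (fun y => u y * sin (w * y))), continuous_mult_sin, Hc. }
  assert (Hdom : forall h : R -> R, (forall y, -1 <= h y <= 1) -> decaying (fun y => u y * h y)).
  { intros h Hh. apply (decaying_le _ u 1 Hu). intros y. rewrite Rabs_mult, Rmult_comm.
    apply Rmult_le_compat_r; [apply Rabs_pos|]. apply Rabs_le, Hh. }
  assert (Hdc : decaying uc) by (apply Hdom; intros; apply COS_bound).
  assert (Hds : decaying us).
  { apply Hdom. intros. generalize (SIN_bound (w * y)). lra. }
  replace (RInt (fun s => zsum u s * cos (w * s)) 0 1) with (RInt (zsum uc) 0 1).
  2: { apply RInt_ext. intros x _. apply (zsum_mult_periodic u (fun y => cos (w * y))).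
       apply cos_IZR_periodic. }
  replace (- RInt (fun s => zsum u s * sin (w * s)) 0 1) with (RInt (zsum us) 0 1).
  2: { rewrite <- (Rmult_1_l (RInt (fun s => _ * _) 0 1)), Ropp_mult_distr_l.
       rewrite <- RInt_scal_cont.
       - apply RInt_ext. intros x _. unfold us.
         rewrite (zsum_mult_periodic u (fun y => - sin (w * y))).
         + simpl; ring.
         + intros y. f_equal. apply sin_IZR_periodic.
       - intros; apply continuous_mult_sin. intros; apply zsum_continuous; assumption. }
  unfold Gamma.
  apply (@is_RInt_gen_unique C_R_CompleteNormedModule (at_right 0) (Rbar_locally p_infty)
    (Proper_StrongProper _ (at_right_proper_filter 0))
    (Proper_StrongProper _ (Rbar_locally_filter p_infty))).
  assert (Hlim : forall (eps : posreal), exists B, forall y z, y <= - B -> B <= z ->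
    Rabs (b * RInt uc y z - b * RInt (zsum uc) 0 1) < eps /\
    Rabs (b * RInt us y z - b * RInt (zsum us) 0 1) < eps).
  { intros eps. assert (He : 0 < eps / b) by (apply Rdiv_lt_0_compat; [apply cond_pos|lra]).
    destruct (RInt_zsum_limit uc Hdc Hcc _ He) as [B1 H1].
    destruct (RInt_zsum_limit us Hds Hcs _ He) as [B2 H2].
    exists (Rmax B1 B2). intros y z Hy Hz.
    generalize (Rmax_l B1 B2) (Rmax_r B1 B2). intros Hl Hr.
    specialize (H1 y z ltac:(lra) ltac:(lra)). specialize (H2 y z ltac:(lra) ltac:(lra)).
    rewrite <- 2!Rmult_minus_distr_l, 2!Rabs_mult, (Rabs_pos_eq b) by lra.
    replace (pos eps) with (b * (eps / b)) by (field; lra).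
    split; apply Rmult_lt_compat_l; assumption. }
  (* The substitution [y = ln t / b] on a compact interval, where no limit is involved. *)
  assert (Hint : forall a c, 0 < a -> 0 < c ->
    is_RInt (V := C_R_NormedModule)
      (fun t => (Rcpow t (alpha_n m D1 n - 1) * RtoC (exp (- t)))%C) a c
      (b * RInt uc (ln a / b) (ln c / b), b * RInt us (ln a / b) (ln c / b))).
  { intros a c Ha Hc0.
    assert (Hcv : forall v : R -> R, (forall x, continuous v x) ->
      is_RInt (fun t => / t * v (ln t / b)) a c (b * RInt v (ln a / b) (ln c / b))).
    { intros v Hv.
      apply (is_RInt_ext (V := R_NormedModule) (fun t => b * (/ (b * t) * v (ln t / b)))).
      { intros t Ht. assert (0 < t) by (generalize (Rmin_glb_lt a c 0 Ha Hc0); lra).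
        change (b * (/ (b * t) * v (ln t / b)) = / t * v (ln t / b)). field. lra. }
      apply (is_RInt_scal (V := R_NormedModule) (fun t => / (b * t) * v (ln t / b))).
      apply (is_RInt_comp (V := R_CompleteNormedModule) v (fun t => ln t / b) (fun t => / (b * t))).
      - intros; apply Hv.
      - intros t Ht. assert (0 < t) by (generalize (Rmin_glb_lt a c 0 Ha Hc0); lra).
        split.
        + auto_derive; [assumption|]. field. lra.
        + apply (ex_derive_continuous (V := R_NormedModule)). auto_derive. nra. }
    apply (is_RInt_ext (V := C_R_NormedModule) (fun t => (/ t * uc (ln t / b), / t * us (ln t / b)))).
    2: { apply (is_RInt_fct_extend_pair (U := R_NormedModule) (V := R_NormedModule));
         simpl; apply Hcv; assumption. }
    intros t Ht. assert (Ht0 : 0 < t) by (generalize (Rmin_glb_lt a c 0 Ha Hc0); lra).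
    unfold uc, us, u, gamma_density.
    replace (b * (ln t / b)) with (ln t) by (field; lra).
    rewrite exp_ln by exact Ht0.
    unfold Rcpow, alpha_n. fold b. 
    replace ((- RtoC (alpha m D1) - 2 * RtoC PI * Ci * RtoC (IZR n) / RtoC b - 1) * RtoC (ln t))%C
      (* The real part of the exponent gives the density, and its imaginary part is the phase
         [- w * y] of the Fourier kernel at [y = ln t / b]. *)
      with ((p - 1) * ln t, - (w * (ln t / b))).
    2: { unfold Cdiv. rewrite <- RtoC_inv by lra.
         unfold Cminus, Cplus, Cmult, Copp, RtoC, Ci, p, w; simpl. f_equal; field; lra. }
    unfold Cexp, Cmult, RtoC; simpl. rewrite cos_neg, sin_neg.
    replace (/ t) with (exp (- ln t)) by (rewrite exp_Ropp, exp_ln by exact Ht0; reflexivity).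
    replace (p * ln t - 1 * t) with ((p - 1) * ln t + ln t + - t) by ring.
    rewrite !exp_plus, exp_Ropp. assert (He := exp_pos (ln t)).
    f_equal; field; lra. }
  intros P [eps HPe]. destruct (Hlim eps) as [B HB].
  (* These neighbourhoods of 0 and of infinity are the images under [t = exp (b * y)] of [y < - B]
     and [y > B]. *)
  exists (fun a => 0 < a < exp (- (b * B))) (fun c => exp (b * B) < c).
  - exists (mkposreal _ (exp_pos (- (b * B)))). intros y Hy Hy0. split; [exact Hy0|].
    unfold ball in Hy; simpl in Hy; unfold AbsRing_ball, abs, minus, plus, opp in Hy; simpl in Hy.
    apply Rabs_def2 in Hy. lra.
  - exists (exp (b * B)). intros; assumption.
  - intros a c [Ha0 Ha] Hc'. assert (Hc0 : 0 < c) by (generalize (exp_pos (b * B)); lra).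
    simpl. eexists. split; [apply Hint; assumption|]. apply HPe.
    assert (Hya : ln a / b <= - B).
    { apply Rle_div_l; [exact Hb|]. apply Rlt_le, exp_lt_inv. rewrite exp_ln by exact Ha0.
      eapply Rlt_le_trans; [exact Ha|]. right; f_equal; ring. }
    assert (Hzc : B <= ln c / b).
    { apply Rle_div_r; [exact Hb|]. apply Rlt_le, exp_lt_inv. rewrite exp_ln by exact Hc0.
      eapply Rle_lt_trans; [|exact Hc']. right; f_equal; ring. }
    destruct (HB _ _ Hya Hzc) as [H1 H2].
    unfold RtoC, Cmult; simpl. split; simpl.
    + unfold ball; simpl; unfold AbsRing_ball, abs, minus, plus, opp; simpl.
      rewrite Rmult_0_l, Rminus_0_r. exact H1.
    + unfold ball; simpl; unfold AbsRing_ball, abs, minus, plus, opp; simpl.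
      rewrite Rmult_0_l, Rplus_0_r. exact H2.
Qed.

(** * Summation over the expansion: the Dirichlet series of zeta *)

(** The two factors are those met on rescaling by [c]: the modulus is the scaling [c ^ alpha], the
    phase is the effect on a Fourier coefficient of a translation by [log_m c]. *)
Lemma Rcpow_alpha_n (m : nat) (D1 D2 c : R) (n : Z) : ladder_parameters m D1 D2 ->
  Rcpow c (- alpha_n m D1 n)
  = (RtoC (exp (- - alpha m D1 * ln c))
     * (cos (2 * PI * IZR n * (ln c / ln (INR m))), sin (2 * PI * IZR n * (ln c / ln (INR m)))))%C.
Proof.
  intros HP. assert (Hb := ln_steps_pos m D1 D2 HP). unfold Rcpow, alpha_n.
  replace (- (- RtoC (alpha m D1) - 2 * RtoC PI * Ci * RtoC (IZR n) / RtoC (ln (INR m))) * RtoC (ln c))%C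
    with (- - alpha m D1 * ln c, 2 * PI * IZR n * (ln c / ln (INR m))).
  - unfold Cexp, Cmult, RtoC; simpl. f_equal; ring.
  - unfold Cdiv. rewrite <- RtoC_inv by lra.
    unfold Cminus, Cplus, Cmult, Copp, RtoC, Ci; simpl. f_equal; field; lra.
Qed.

Lemma fourier_planck_rest_step (m : nat) (D1 D2 : R) (n : Z) (J : nat) :
  ladder_parameters m D1 D2 -> 0 < D2 ->
  let b := ln (INR m) in let p := - alpha m D1 in
  fourier_coef (zsum (planck_rest b p J)) n
  = (Rcpow (INR (S J)) (- alpha_n m D1 n) * fourier_coef (zsum (gamma_density b p 1)) n
     + fourier_coef (zsum (planck_rest b p (S J))) n)%C.
Proof.
  intros HP HD2 b p.
  assert (Hb : 0 < b) by apply (ln_steps_pos m D1 D2 HP).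
  assert (Hp : 1 < p) by apply (alpha_lt m D1 D2 HP HD2).
  assert (Hg : decaying (gamma_density b p 1)) by (apply gamma_density_decaying; lra).
  assert (Hgc : forall x, continuous (zsum (gamma_density b p 1)) x).
  { intros. apply zsum_continuous; [exact Hg|]. intros; apply gamma_density_continuous. }
  set (c := INR (S J)).
  rewrite (fourier_coef_ext _ _ n (fun x => zsum_planck_rest_step b p x J Hb Hp)).
  fold c.
  rewrite (fourier_coef_plus (fun x => exp (- p * ln c) * zsum (gamma_density b p 1) (x + ln c / b))).
  - f_equal.
    rewrite (fourier_coef_scal _ (fun x => zsum (gamma_density b p 1) (x + ln c / b))).
    + rewrite fourier_coef_shift; [|exact Hgc|intros; apply zsum_periodic, Hg].
      rewrite (Rcpow_alpha_n m D1 D2) by exact HP. apply Cmult_assoc.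
    + intros. apply (continuous_shift (zsum (gamma_density b p 1))), Hgc.
  - intros. apply continuous_scal_cont, (continuous_shift (zsum (gamma_density b p 1))), Hgc.
  - intros. apply zsum_continuous; [apply planck_rest_decaying; assumption|].
    intros; apply planck_rest_continuous.
Qed.

(** A coefficient is at most the supremum of its function, here [M * (J + 1) ^ (1 - p)], which tends
    to 0 because [1 < p]. *)
Lemma fourier_planck_rest_lim (b p : R) (n : Z) : 0 < b -> 1 < p ->
  is_lim_seq (fun J => Re (fourier_coef (zsum (planck_rest b p (S J))) n)) 0 /\
  is_lim_seq (fun J => Im (fourier_coef (zsum (planck_rest b p (S J))) n)) 0.
Proof.
  intros Hb Hp. destruct (zsum_planck_rest_le b p Hb Hp) as [M HM].
  assert (Hbd := fun J => fourier_coef_bound (zsum (planck_rest b p (S J))) n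
    (M * exp (- (p - 1) * ln (INR (S J))))
    (fun x => zsum_continuous _ x (planck_rest_decaying b p (S J) Hb Hp)
                (planck_rest_continuous b p (S J)))
    (fun x => Rle_trans _ _ _ (Req_le _ _ (Rabs_pos_eq _ (proj1 (HM J x)))) (proj2 (HM J x)))).
  assert (HL : is_lim_seq (fun J => M * exp (- (p - 1) * ln (INR (S J)))) 0).
  { replace (Finite 0) with (Rbar_mult M 0) by (simpl; f_equal; ring).
    apply (is_lim_seq_scal_l (fun J => exp (- (p - 1) * ln (INR (S J)))) M 0).
    apply (filterlim_comp _ _ _ (fun J => - (p - 1) * ln (INR (S J))) exp _ (Rbar_locally m_infty)).
    2: apply is_lim_exp_m.
    replace m_infty with (Rbar_mult (- (p - 1)) p_infty).
    2: { simpl. destruct Rle_dec; [exfalso; lra|reflexivity]. }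
    apply (is_lim_seq_scal_l (fun J => ln (INR (S J))) (- (p - 1)) p_infty).
    apply (filterlim_comp _ _ _ (fun J => INR (S J)) ln _ (Rbar_locally p_infty)).
    2: apply is_lim_ln_p.
    apply -> is_lim_seq_incr_1. apply is_lim_seq_INR. }
  split; apply is_lim_seq_abs_0;
    apply (is_lim_seq_le_le (fun _ => 0) _ (fun J => M * exp (- (p - 1) * ln (INR (S J)))));
    try exact HL; try apply is_lim_seq_const;
    intros J; (split; [apply Rabs_pos|apply Hbd]).
Qed.

(* For [a = 0] nothing makes [CSeries z] converge; its junk value is then
   multiplied by 0. *)
Lemma CSeries_telescope (z r : nat -> C) (a : C) :
  (forall j, r j = (z j * a + r (S j))%C) ->
  is_lim_seq (fun j => Re (r (S j))) 0 -> is_lim_seq (fun j => Im (r (S j))) 0 ->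
  (a * CSeries z)%C = r 0%nat.
Proof.
  intros Hr HRe HIm. destruct a as [A B].
  set (P := fun J => sum_n (fun j => Re (z j)) J).
  set (Q := fun J => sum_n (fun j => Im (z j)) J).
  assert (Hsum : forall J, Re (r 0%nat) - Re (r (S J)) = A * P J - B * Q J /\
                           Im (r 0%nat) - Im (r (S J)) = A * Q J + B * P J).
  { unfold P, Q. induction J as [|J [IH1 IH2]].
    - rewrite 2!sum_O, (Hr 0%nat). unfold Re, Im; simpl. split; ring.
    - rewrite 2!sum_Sn. unfold plus; simpl.
      rewrite (Hr (S J)) in IH1, IH2. unfold Re, Im in *; simpl in IH1, IH2. split; lra. }
  assert (LRe : is_lim_seq (fun J => A * P J - B * Q J) (Re (r 0%nat))).
  { apply (is_lim_seq_ext (fun J => Re (r 0%nat) - Re (r (S J)))); [intros; apply Hsum|].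
    replace (Finite (Re (r 0%nat))) with (Finite (Re (r 0%nat) - 0)) by (f_equal; ring).
    apply is_lim_seq_minus'; [apply is_lim_seq_const|exact HRe]. }
  assert (LIm : is_lim_seq (fun J => A * Q J + B * P J) (Im (r 0%nat))).
  { apply (is_lim_seq_ext (fun J => Im (r 0%nat) - Im (r (S J)))); [intros; apply Hsum|].
    replace (Finite (Im (r 0%nat))) with (Finite (Im (r 0%nat) - 0)) by (f_equal; ring).
    apply is_lim_seq_minus'; [apply is_lim_seq_const|exact HIm]. }
  destruct (Req_dec (A * A + B * B) 0) as [HD|HD].
  (* With [a = 0] the recurrence makes [r] constant, and its limit is 0. *)
  - assert (HA : A = 0) by nra. assert (HB : B = 0) by nra. subst A B.
    assert (H1 : Re (r 0%nat) = 0).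
    { apply (is_lim_seq_ext _ (fun _ => 0)) in LRe; [|intros; ring].
      apply is_lim_seq_unique in LRe. rewrite Lim_seq_const in LRe.
      injection LRe; auto. }
    assert (H2 : Im (r 0%nat) = 0).
    { apply (is_lim_seq_ext _ (fun _ => 0)) in LIm; [|intros; ring].
      apply is_lim_seq_unique in LIm. rewrite Lim_seq_const in LIm.
      injection LIm; auto. }
    destruct (r 0%nat) as [x y]; simpl in H1, H2. subst.
    unfold Cmult; simpl. f_equal; ring.
  (* Multiplying by the conjugate of [a] over [D], its squared modulus, isolates the partial sums of
     [z]; convergence of the series is thereby obtained, not assumed. *)
  - set (D := A * A + B * B) in *. set (x := Re (r 0%nat)) in *. set (y := Im (r 0%nat)) in *.
    assert (LP : is_series (fun j => Re (z j)) (/ D * (A * x + B * y))).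
    { change (is_lim_seq P (/ D * (A * x + B * y))).
      apply (is_lim_seq_ext (fun J => / D * (A * (A * P J - B * Q J) + B * (A * Q J + B * P J)))).
      { intros J. unfold D. field. exact HD. }
      apply (is_lim_seq_scal_l _ (/ D) (A * x + B * y)).
      apply is_lim_seq_plus'.
      - apply (is_lim_seq_scal_l _ A x LRe).
      - apply (is_lim_seq_scal_l _ B y LIm). }
    assert (LQ : is_series (fun j => Im (z j)) (/ D * (A * y - B * x))).
    { change (is_lim_seq Q (/ D * (A * y - B * x))).
      apply (is_lim_seq_ext (fun J => / D * (A * (A * Q J + B * P J) - B * (A * P J - B * Q J)))).
      { intros J. unfold D. field. exact HD. }
      apply (is_lim_seq_scal_l _ (/ D) (A * y - B * x)).
      apply is_lim_seq_minus'.
      - apply (is_lim_seq_scal_l _ A y LIm).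
      - apply (is_lim_seq_scal_l _ B x LRe). }
    unfold CSeries. rewrite (is_series_unique _ _ LP), (is_series_unique _ _ LQ).
    rewrite (surjective_pairing (r 0%nat)). fold (Re (r 0%nat)) (Im (r 0%nat)). fold x y.
    unfold Cmult; simpl. unfold D. f_equal; field; exact HD.
Qed.

Theorem theorem1 :
  forall (m : nat) (D1 D2 : R) (L : R -> R),
    ladder_parameters m D1 D2 ->
    0 < D2 ->
    is_regular_ladder m D1 D2 L ->
    forall n : Z,
      fourier_coef (Phi m D1 L) n =
      (RtoC (D2 * (1 - D1) / (D1 * ln (INR m)))
       * Gamma (alpha_n m D1 n) * zeta (alpha_n m D1 n))%C.
Proof.
  intros m D1 D2 L HP HD2 HL n.
  assert (Hb := ln_steps_pos m D1 D2 HP). assert (Hp := alpha_lt m D1 D2 HP HD2).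
  assert (HD1 := ladder_D1 _ _ _ HP).
  rewrite (fourier_coef_ext _ _ n (fun x => Phi_planck m D1 D2 L x HP HD2 HL)).
  rewrite (Gamma_fourier m D1 D2 n HP HD2).
  set (b := ln (INR m)) in *. set (p := - alpha m D1) in *.
  rewrite fourier_coef_scal.
  2: { intros. apply zsum_continuous; [apply planck_decaying; assumption|].
       intros; apply planck_continuous. }
  set (G := fourier_coef (zsum (gamma_density b p 1)) n).
  assert (HW : (G * zeta (alpha_n m D1 n))%C = fourier_coef (zsum (planck b p)) n).
  { destruct (fourier_planck_rest_lim b p n Hb Hp) as [H1 H2].
    rewrite (fourier_coef_ext (zsum (planck b p)) (zsum (planck_rest b p 0))).
    2: { intros x. apply zsum_ext. intros y. unfold planck_rest.
         simpl. rewrite Rmult_0_l, Ropp_0, exp_0. ring. }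
    (* The [j]-th term of [zeta] has base [S j], which is the index of the term split off from the
       [j]-th remainder. *)
    apply (CSeries_telescope _ (fun j => fourier_coef (zsum (planck_rest b p j)) n));
      [|exact H1|exact H2].
    intros j. apply (fourier_planck_rest_step m D1 D2 n j HP HD2). }
  rewrite <- HW.
  (* The inserted [b] is the factor [ln m] relating [G] to [Gamma]. *)
  replace (D2 * (1 - D1) / D1) with (D2 * (1 - D1) / (D1 * b) * b) by (field; lra).
  rewrite RtoC_mult, !Cmult_assoc. reflexivity.
Qed.
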